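(* The shortest (solid) cover of an indeterminate string of length $n$ with $k$ non-solid symbols over an alphabet of size $\sigma$ can be computed in $\mathcal{O}(n\sigma^{k/2}k)$ time.
   Context: An indeterminate string (i-string) $T$ of length $n$ over a finite alphabet $\Sigma$, $\sigma=|\Sigma|$, $2\le\sigma\le n$, is a sequence of nonempty subsets $T[1],\ldots,T[n]$ of $\Sigma$; positions with $|T[i]|=1$ are solid, others non-solid, and $k$ denotes the number of non-solid positions. Non-solid symbols are given as bit vectors of size $\sigma$. A solid string is an i-string with only solid positions. Two i-strings $U,V$ match ($U\approx V$) if $|U|=|V|$ and $U[i]\cap V[i]\neq\emptyset$ for all $i$. A solid string $S$ occurs in $T$ at position $j$ if $S\approx T[j..j+|S|-1]$; $\mathit{Occ}(S,T)$ denotes the set of such $j$. A cover of $T$ is a solid string $S$ such that for every position $i$ of $T$, $\mathit{Occ}(S,T)\cap\{i-|S|+1,\ldots,i\}\neq\emptyset$. The task is to compute the length of a shortest cover. *)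

(* Defs.v *)
From mathcomp Require Import all_boot.

Set Implicit Arguments.
Unset Strict Implicit.
Unset Printing Implicit Defensive.

(** * Indeterminate strings and covers

    Positions are numbered from 0. *)

Section IndeterminateStrings.
Variable Sigma : finType.
Implicit Types (A B : {set Sigma}) (S T U V : seq {set Sigma}).

Definition istring T : bool := all (fun A => A != set0) T.

Definition solid_sym A : bool := #|A| == 1.

Definition nonsolid_count T : nat := count (fun A => ~~ solid_sym A) T.

Definition solid_string S : bool := istring S && all solid_sym S.

(* [all2] is false on sequences of different lengths. *)
Definition imatch U V : bool := all2 (fun A B => A :&: B != set0) U V.

(* [take] and [drop] truncate silently at the end of [T], but the length test
   in [imatch] rejects a factor shorter than [S]. *)
Definition occurs S T (j : nat) : bool := imatch S (take (size S) (drop j T)).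

(* The window {i-|S|+1, ..., i} is written j <= i < j + |S|; it is empty for
   the empty string, which therefore covers no nonempty T. *)
Definition cover S T : Prop :=
  solid_string S /\
  forall i, i < size T -> exists2 j, j <= i < j + size S & occurs S T j.

Definition shortest_cover_length T (m : nat) : Prop :=
  (exists2 S, cover S T & size S = m) /\
  (forall S, cover S T -> m <= size S).

End IndeterminateStrings.

(** * Word RAM

    While-programs over [w]-bit words with unit cost. A state has registers
    and arrays, both named by constants of the program (a program thus uses
    constantly many of each); arrays are indexed by computed words. All
    arithmetic is modulo [2 ^ w]. *)

Inductive binop :=
  | Add | Sub | Mul | Div | Mod | And | Or | Xor | Shl | Shr | Lt | Eq.

Inductive expr :=
  | Const of nat
  | Reg of nat
  | Get of nat & expr                (* array name, index *)
  | Bin of binop & expr & expr.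

Inductive cmd :=
  | Skip
  | Assign of nat & expr             (* register, value *)
  | Store of nat & expr & expr       (* array name, index, value *)
  | Comp of cmd & cmd
  | If of expr & cmd & cmd
  | While of expr & cmd.

Record state := State { regs : nat -> nat; arrays : nat -> nat -> nat }.

Definition word (w x : nat) : nat := x %% 2 ^ w.

Definition eval_op (w : nat) (o : binop) (x y : nat) : nat :=
  word w match o with
  | Add => x + y
  | Sub => x + (2 ^ w - y)
  | Mul => x * y
  | Div => x %/ y
  | Mod => x %% y
  | And => Nat.land x y
  | Or => Nat.lor x y
  | Xor => Nat.lxor x y
  | Shl => x * 2 ^ y
  | Shr => x %/ 2 ^ y
  | Lt => x < y
  | Eq => x == y
  end.

Fixpoint eval (w : nat) (s : state) (e : expr) : nat :=
  match e with
  | Const c => word w c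
  | Reg r => regs s r
  | Get a i => arrays s a (eval w s i)
  | Bin o e1 e2 => eval_op w o (eval w s e1) (eval w s e2)
  end.

Fixpoint cost (e : expr) : nat :=
  match e with
  | Const _ | Reg _ => 1
  | Get _ i => (cost i).+1
  | Bin _ e1 e2 => (cost e1 + cost e2).+1
  end.

Definition set_reg (s : state) (r v : nat) : state :=
  State (fun r' => if r' == r then v else regs s r') (arrays s).

Definition set_cell (s : state) (a i v : nat) : state :=
  State (regs s)
    (fun a' i' => if (a' == a) && (i' == i) then v else arrays s a' i').

(* [exec w p s t s']: started in [s], the program [p] halts in [s'] after
   exactly [t] time units. The relation is deterministic. *)
Inductive exec (w : nat) : cmd -> state -> nat -> state -> Prop :=
  | exec_skip s : exec w Skip s 1 s
  | exec_assign r e s :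
      exec w (Assign r e) s (cost e).+1 (set_reg s r (eval w s e))
  | exec_store a i e s :
      exec w (Store a i e) s (cost i + cost e).+1
           (set_cell s a (eval w s i) (eval w s e))
  | exec_comp p q s1 s2 s3 t1 t2 :
      exec w p s1 t1 s2 -> exec w q s2 t2 s3 ->
      exec w (Comp p q) s1 (t1 + t2) s3
  | exec_if e p q s s' t :
      exec w (if eval w s e != 0 then p else q) s t s' ->
      exec w (If e p q) s (cost e + t).+1 s'
  | exec_while_end e p s :
      eval w s e = 0 -> exec w (While e p) s (cost e).+1 s
  | exec_while_step e p s1 s2 s3 t1 t2 :
      eval w s1 e != 0 ->
      exec w p s1 t1 s2 -> exec w (While e p) s2 t2 s3 ->
      exec w (While e p) s1 (cost e + t1 + t2).+1 s3.

(** * Input convention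

    Over the alphabet {0, ..., sigma - 1}:
    - register 0 holds the length n and register 1 holds sigma;
    - cell i of array 0 holds the letter a if T[i] = {a}, and sigma + j if T[i]
      is the j-th non-solid symbol of T (j counted from 0);
    - array 1 is the concatenation of the bit vectors of the non-solid symbols,
      one bit per cell: cell j * sigma + a tells whether the j-th of them
      contains the letter a;
    - everything else is 0. *)

Section Input.
Variable sigma : nat.
Implicit Type T : seq {set 'I_sigma}.

Definition letter (A : {set 'I_sigma}) : nat :=
  if [pick a in A] is Some a then val a else 0.

Definition symbol_codes T : seq nat :=
  mkseq (fun i => let A := nth set0 T i in
                  if solid_sym A then letter A
                  else sigma + nonsolid_count (take i T)) (size T).

Definition bit_vector (A : {set 'I_sigma}) : seq nat :=
  [seq nat_of_bool (a \in A) | a <- enum 'I_sigma].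

Definition bit_vectors T : seq nat :=
  flatten [seq bit_vector A | A <- T & ~~ solid_sym A].

Definition input_state (w : nat) T : state :=
  State (fun r => word w (nth 0 [:: size T; sigma] r))
        (fun a i => word w (nth 0 (nth [::] [:: symbol_codes T; bit_vectors T] a) i)).

End Input.

(* Main.v *)
Require Import Defs.
From mathcomp Require Import all_boot all_order all_algebra.
From mathcomp Require Import reals exp.
From mathcomp Require Import zify.

Import Order.TTheory GRing.Theory Num.Theory.

Set Implicit Arguments.
Unset Strict Implicit.
Unset Printing Implicit Defensive.

(** A cover S of length m <= n/2 is a prefix of a filling of the first half of
    T. Covers of T and of its reversal correspond, so the first half may be
    assumed to contain at most k/2 non-solid positions, which leaves at most
    sigma^(k/2) fillings. For one filling S, let P[d] be the length of the
    longest prefix of S that matches T at d. Between consecutive non-solid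
    positions of T matching is equality of letters, so all the P[d] come from
    k + 1 runs of the Z-algorithm. The prefix of length m is a cover iff m <= P[0]
    and two consecutive d with P[d] >= m, or the last one and n, are at distance
    at most m. The largest such distance for each m is read off a monotone stack.

    A cover of length m > n/2 exists iff T[0..m) matches T[n-m..n). Each shift
    d = n - m is tested by comparing, for every non-solid p, the pairs p, p + d
    and p, p - d, and the maximal runs of equal letters starting right after
    them: again k + 1 runs of the Z-algorithm. *)

(** * A program logic with exact running times *)

(** Why lengths m > n/2 need no enumeration: the occurrence covering position 0 starts at 0, the one
    covering the last position ends there, and these two already cover T. Position i of the cover is
    then constrained only by T[i] and T[i+d], so its letters can be chosen independently. For m <=
    n/2 one letter may face many positions of T at once, and the first half has to be filled.

    The number of fillings can exceed 2^w, so no register counts them: the filling is incremented in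
    place like an odometer, and its overflow ends the loop.

    Bit vectors have one bit per cell, so comparing two non-solid symbols costs sigma, in total k *
    k * sigma over all pairs. If k >= 2 this is at most n * k * sigma^(k/2) even with k/2 rounded
    down, because the exponent is at least 1; if k <= 1 it is at most sigma <= n. *)

Fixpoint wregs (p : cmd) : seq nat :=
  match p with
  | Assign r _ => [:: r]
  | Comp p q | If _ p q => wregs p ++ wregs q
  | While _ p => wregs p
  | _ => [::]
  end.

Fixpoint warrs (p : cmd) : seq nat :=
  match p with
  | Store a _ _ => [:: a]
  | Comp p q | If _ p q => warrs p ++ warrs q
  | While _ p => warrs p
  | _ => [::]
  end.

Definition frame (rs az : seq nat) (s s' : state) : Prop :=
  (forall r, r \notin rs -> regs s' r = regs s r) /\
  (forall a i, a \notin az -> arrays s' a i = arrays s a i).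

Lemma frame_refl rs az s : frame rs az s s.
Proof. by split. Qed.

Lemma frame_trans rs az s1 s2 s3 :
  frame rs az s1 s2 -> frame rs az s2 s3 -> frame rs az s1 s3.
Proof.
by move=> [r1 a1] [r2 a2]; split=> *; rewrite ?r2 ?r1 ?a2 ?a1.
Qed.

Lemma frame_sub rs az rs' az' s s' :
  {subset rs <= rs'} -> {subset az <= az'} ->
  frame rs az s s' -> frame rs' az' s s'.
Proof.
move=> sr sa [Hr Ha]; split=> [r|a i] ni; [apply: Hr|apply: Ha].
  by apply: contra ni; apply: sr.
by apply: contra ni; apply: sa.
Qed.

Lemma exec_frame w p s t s' : exec w p s t s' -> frame (wregs p) (warrs p) s s'.
Proof.
elim=> {p s t s'} [s|r e s|a i e s|p q s1 s2 s3 t1 t2 _ IH1 _ IH2|e p q s s' t _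
  |e p s _|e p s1 s2 s3 t1 t2 _ _ IH1 _ IH2].
- exact: frame_refl.
- by split=> // r'; rewrite inE /= => /negbTE ->.
- by split=> // a' i'; rewrite inE /= => /negbTE ->.
- apply: (@frame_trans _ _ _ s2); [apply: frame_sub IH1|apply: frame_sub IH2];
    by move=> x; rewrite mem_cat => ->; rewrite ?orbT.
- by case: ifP => _ IH; apply: frame_sub IH => x; rewrite /= mem_cat => ->; rewrite ?orbT.
- exact: frame_refl.
- exact: frame_trans IH1 IH2.
Qed.

(** Total correctness with the running time as an argument of the postcondition, so that time bounds
    and results are proved in one pass. *)
Definition wp w p s (Q : nat -> state -> Prop) : Prop :=
  exists t s', exec w p s t s' /\ Q t s'.

Definition framed p := frame (wregs p) (warrs p).

Section Rules.
Variable w : nat.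
Implicit Types (p q : cmd) (e : expr) (s : state) (Q : nat -> state -> Prop).

(** The frame is read off the syntax of [p] and handed to the continuation, so specifications of
    subprograms need not list what they leave unchanged. *)
Lemma wp_conseq p s Q0 Q :
  wp w p s Q0 ->
  (forall t s', framed p s s' -> Q0 t s' -> Q t s') -> wp w p s Q.
Proof.
move=> [t [s' [He HQ]]] H; exists t, s'; split=> //.
exact: H (exec_frame He) HQ.
Qed.

Lemma wp_skip s Q : Q 1 s -> wp w Skip s Q.
Proof. by exists 1, s; split=> //; apply: exec_skip. Qed.

Lemma wp_assign r e s Q :
  Q (cost e).+1 (set_reg s r (eval w s e)) -> wp w (Assign r e) s Q.
Proof. by move=> H; do 2!eexists; split; [apply: exec_assign|]. Qed.

Lemma wp_store a i e s Q :
  Q (cost i + cost e).+1 (set_cell s a (eval w s i) (eval w s e)) ->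
  wp w (Store a i e) s Q.
Proof. by move=> H; do 2!eexists; split; [apply: exec_store|]. Qed.

Lemma wp_comp p q s Q :
  wp w p s (fun t1 s1 => wp w q s1 (fun t2 s2 => Q (t1 + t2) s2)) ->
  wp w (Comp p q) s Q.
Proof.
move=> [t1 [s1 [H1 [t2 [s2 [H2 HQ]]]]]].
by exists (t1 + t2), s2; split=> //; apply: exec_comp H1 H2.
Qed.

Lemma wp_if_neq0 e p q s Q :
  (eval w s e != 0 -> wp w p s (fun t => Q (cost e + t).+1)) ->
  (eval w s e = 0 -> wp w q s (fun t => Q (cost e + t).+1)) ->
  wp w (If e p q) s Q.
Proof.
move=> H1 H2.
case: (eqVneq (eval w s e) 0) => He; [have := H2 He|have := H1 He];
  by case=> t [s' [Hex HQ]]; exists (cost e + t).+1, s'; split=> //;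
     apply: exec_if; rewrite He.
Qed.

Lemma wp_if (b : bool) e p q s Q :
  eval w s e = b ->
  (b -> wp w p s (fun t => Q (cost e + t).+1)) ->
  (~~ b -> wp w q s (fun t => Q (cost e + t).+1)) ->
  wp w (If e p q) s Q.
Proof.
by case: b => He H1 H2; apply: wp_if_neq0; rewrite He // => _; by [apply: H1|apply: H2].
Qed.

(* The index of [I] bounds the number of iterations that are still to come. *)
Lemma wp_while (I : nat -> state -> Prop) (c : nat) e p s Q m :
  I m s ->
  (forall m1 s1, framed p s s1 -> I m1 s1 -> eval w s1 e != 0 ->
     wp w p s1 (fun t s2 => t <= c /\ exists2 m2, m2 < m1 & I m2 s2)) ->
  (forall t m2 s2, framed p s s2 -> I m2 s2 -> eval w s2 e = 0 ->
     t <= m * (c + cost e).+1 + (cost e).+1 -> Q t s2) ->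
  wp w (While e p) s Q.
Proof.
move=> I0 Hb HQ.
suff: forall m1 s1, m1 <= m -> framed p s s1 -> I m1 s1 ->
    wp w (While e p) s1 (fun t s2 => [/\ framed p s s2, exists m2, I m2 s2,
       eval w s2 e = 0 & t <= m1 * (c + cost e).+1 + (cost e).+1]).
  move=> /(_ m s (leqnn m) (frame_refl _ _ _) I0) [t [s' [He [F [m2 I2] E T]]]].
  exists t, s'; split=> //; exact: HQ F I2 E T.
move=> m1; elim/ltn_ind: m1 => m1 IH s1 le_m1 F1 I1.
case: (eqVneq (eval w s1 e) 0) => [E|E].
  exists (cost e).+1, s1; split; first exact: exec_while_end.
  by split=> //; [exists m1|rewrite leq_addl].
have [t1 [s2 [He [Ht [m2 lt2 I2]]]]] := Hb m1 s1 F1 I1 E.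
have F2 := frame_trans F1 (exec_frame He).
have [t2 [s3 [He2 [F3 I3 E3 Ht2]]]] :=
  IH m2 lt2 s2 (leq_trans (ltnW lt2) le_m1) F2 I2.
exists (cost e + t1 + t2).+1, s3; split; first exact: exec_while_step He He2.
split=> //.
apply: (@leq_trans ((c + cost e).+1 + (m2 * (c + cost e).+1 + (cost e).+1)));
  first by lia.
by rewrite addnA leq_add2r -mulSn leq_mul2r lt2 orbT.
Qed.

Lemma word_id x : x < 2 ^ w -> word w x = x.
Proof. by move=> H; rewrite /word modn_small. Qed.

Lemma opAdd x y : x + y < 2 ^ w -> eval_op w Add x y = x + y.
Proof. exact: word_id. Qed.
Lemma opMul x y : x * y < 2 ^ w -> eval_op w Mul x y = x * y.
Proof. exact: word_id. Qed.
Lemma opSub x y : y <= x < 2 ^ w -> eval_op w Defs.Sub x y = x - y.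
Proof.
move=> /andP [le_yx lt_x]; rewrite /eval_op /word.
have -> : x + (2 ^ w - y) = (x - y) + 2 ^ w by lia.
by rewrite modnDr modn_small //; lia.
Qed.
Lemma opDiv x y : x < 2 ^ w -> eval_op w Div x y = x %/ y.
Proof. by move=> H; rewrite /eval_op word_id // (leq_ltn_trans _ H) // leq_div. Qed.

Hypothesis w_gt0 : 0 < w.

Lemma two_le : 1 < 2 ^ w.
Proof. by rewrite -{1}(expn0 2) ltn_exp2l. Qed.

Lemma word_bool (b : bool) : word w b = b.
Proof. by rewrite word_id //; case: b; rewrite ?two_le // ltnW // two_le. Qed.

Lemma opLt x y : eval_op w Lt x y = (x < y).
Proof. exact: word_bool. Qed.
Lemma opEq x y : eval_op w Eq x y = (x == y).
Proof. exact: word_bool. Qed.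
Lemma opMulb (b1 b2 : bool) : eval_op w Mul b1 b2 = b1 && b2.
Proof. by rewrite /eval_op mulnb word_bool. Qed.

End Rules.

Definition For (r x : nat) (body : cmd) : cmd :=
  Comp (Assign r (Const 0))
    (While (Bin Lt (Reg r) (Reg x))
       (Comp body (Assign r (Bin Add (Reg r) (Const 1))))).

(** The body must establish the invariant for every state that differs from its result in [r] only,
    since the counter is incremented afterwards. An iteration costs 8 beyond the body: 4 for the
    test and 4 for the increment. The remaining 6 pay for the initial assignment and the last
    test. *)
Lemma wp_for w (I : nat -> state -> Prop) (c : nat -> nat) r x body s Q :
  0 < w ->
  r \notin wregs body -> x \notin wregs body -> x != r ->
  regs s x < 2 ^ w ->
  (forall s1, framed (For r x body) s s1 ->
     arrays s1 = arrays s -> regs s1 r = 0 ->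
     (forall r', r' != r -> regs s1 r' = regs s r') -> I 0 s1) ->
  (forall i s1, i < regs s x -> framed (For r x body) s s1 -> regs s1 r = i ->
     I i s1 -> wp w body s1 (fun t s2 => t <= c i /\
       forall s3, (forall r', r' != r -> regs s3 r' = regs s2 r') ->
         arrays s3 = arrays s2 -> I i.+1 s3)) ->
  (forall t s2, framed (For r x body) s s2 -> I (regs s x) s2 ->
     t <= \sum_(i < regs s x) (c i + 8) + 6 -> Q t s2) ->
  wp w (For r x body) s Q.
Proof.
move=> w0 Nr Nx xr Hx I0 Hb HQ.
set N := regs s x in Hx Hb HQ.
have wW : 1 < 2 ^ w by apply: two_le.
apply: wp_comp; apply: wp_assign; rewrite /= word_id //; last by lia.
set s0 := set_reg _ _ _.
have F0 : framed (For r x body) s s0.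
  by split=> // r'; rewrite /= inE mem_cat !inE; case: eqP.
have I00 : I 0 s0.
  by apply: I0 => //=; [rewrite eqxx | move=> r' /negbTE /= ->].
have Fx s1 : framed (For r x body) s s1 -> regs s1 x = N.
  by case=> + _; apply; rewrite /= inE mem_cat !inE (negbTE Nx) (negbTE xr).
suff: forall m i s1, m + i = N -> framed (For r x body) s s1 -> regs s1 r = i ->
    I i s1 ->
    wp w (While (Bin Lt (Reg r) (Reg x))
       (Comp body (Assign r (Bin Add (Reg r) (Const 1))))) s1
     (fun t s2 => [/\ framed (For r x body) s s2, I N s2 &
        t <= \sum_(i <= j < N) (c j + 8) + 4]).
  move=> /(_ N 0 s0 (addn0 _) F0) H.
  apply: wp_conseq (H _ I00) _; first by rewrite /= eqxx.
  move=> t s' _ [F1 I1 T1]; apply: HQ=> //.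
  by rewrite big_mkord in T1; lia.
elim=> [|m IH] i s1 Emi F1 Ei I1.
  exists 4, s1; split.
    apply: exec_while_end; rewrite /= opLt // Ei Fx //.
    by move: Emi; rewrite add0n => ->; rewrite ltnn.
  by move: Emi; rewrite add0n => <-; rewrite big_geq.
have lt_iN : i < N by lia.
have [t1 [s2 [He [Ht I2]]]] := Hb i s1 lt_iN F1 Ei I1.
have F2 : framed (For r x body) s s2.
  apply: frame_trans F1 _; apply: frame_sub (exec_frame He) => y;
  by rewrite /= ?inE ?cats0 ?mem_cat => ->; rewrite ?orbT.
have Er : regs s2 r = i by case: (exec_frame He) => -> // _.
pose s3 := set_reg s2 r i.+1.
have F3 : framed (For r x body) s s3.
  apply: frame_trans F2 _; split=> // r'.
  by rewrite /= inE mem_cat !inE; case: eqP.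
have Em : m + i.+1 = N by lia.
have E3 : regs s3 r = i.+1 by rewrite /= eqxx.
have I3 : I i.+1 s3 by apply: I2 => //= r' /negbTE /= ->.
have [t2 [s4 [He2 [F4 I4 T4]]]] := IH i.+1 s3 Em F3 E3 I3.
exists ((3 + (t1 + 4) + t2).+1), s4; split.
  apply: exec_while_step He2.
    by rewrite /= opLt // Ei Fx // lt_iN.
  apply: exec_comp He _.
  have -> : s3 = set_reg s2 r (eval w s2 (Bin Add (Reg r) (Const 1))).
    rewrite /s3 /= Er word_id // opAdd ?addn1 //.
    by lia.
  exact: exec_assign.
split=> //; rewrite big_ltn //; lia.
Qed.

(** * The Z-algorithm *)

Declare Scope ram_scope.
Delimit Scope ram_scope with ram.
Bind Scope ram_scope with expr.
Bind Scope ram_scope with cmd.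

Notation "# r" := (Reg r) (at level 2, r at level 1, format "# r") : ram_scope.
Notation "a @[ i ]" := (Get a i%ram) (at level 2, i at level 200, format "a @[ i ]") : ram_scope.
Notation "e1 + e2" := (Bin Add e1 e2) : ram_scope.
Notation "e1 - e2" := (Bin Defs.Sub e1 e2) : ram_scope.
Notation "e1 * e2" := (Bin Mul e1 e2) : ram_scope.
Notation "e1 / e2" := (Bin Div e1 e2) : ram_scope.
Notation "e1 < e2" := (Bin Lt e1 e2) : ram_scope.
Notation "e1 == e2" := (Bin Eq e1 e2) : ram_scope.
Notation "0" := (Const 0) : ram_scope.
Notation "1" := (Const 1) : ram_scope.
Notation "r ::= e" := (Assign r e%ram) (at level 80, no associativity) : ram_scope.
Notation "a @[ i ] ::= e" := (Store a i%ram e%ram)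
  (at level 2, i at level 200, e at level 70) : ram_scope.
Notation "p ;; q" := (Comp p q) (at level 90, right associativity) : ram_scope.

(** * Symbolic execution of programs *)

Ltac no_ops t :=
  lazymatch t with
  | context [eval_op _ _ _ _] => fail
  | context [word _ _] => fail
  | _ => idtac
  end.

Ltac rew_regs :=
  repeat match goal with
  | H : regs ?s ?r = _ |- context [regs ?s ?r] => rewrite H
  | H : arrays ?s ?a ?i = _ |- context [arrays ?s ?a ?i] => rewrite H
  end.

Ltac ev_side := solve [assumption | lia].

(** Operations are evaluated from the inside out, so each overflow condition is plain arithmetic for
    [lia]. A product is first tried as a conjunction of booleans, which is how the programs express
    [and]. *)
Ltac ev1 :=
  match goal with
  | |- context [word ?w ?x] => no_ops x; rewrite (@word_id w x); [|ev_side]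
  | |- context [eval_op ?w ?o ?x ?y] => no_ops x; no_ops y;
    lazymatch o with
    | Add => rewrite (@opAdd w x y); [|ev_side]
    | Defs.Sub => rewrite (@opSub w x y); [|ev_side]
    | Mul => first [rewrite opMulb; [|ev_side] | rewrite (@opMul w x y); [|ev_side]]
    | Div => rewrite (@opDiv w x y); [|ev_side]
    | Lt => rewrite (@opLt w ltac:(ev_side) x y)
    | Eq => rewrite (@opEq w ltac:(ev_side) x y)
    end
  end.

Ltac ev := cbn [eval]; rewrite /=; rew_regs; repeat (ev1; rew_regs).

Ltac step :=
  match goal with
  | |- wp _ (Comp _ _) _ _ => apply: wp_comp
  | |- wp _ (Assign _ _) _ _ => apply: wp_assign; ev
  | |- wp _ (Store _ _ _) _ _ => apply: wp_store; ev
  | |- wp _ Skip _ _ => apply: wp_skip; ev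
  end.
Ltac ifs := apply: wp_if; [by ev; rew_regs; reflexivity | |].
Ltac steps := repeat step.

(* Use of the memory by the programs below.
   Registers: 0, 1, 2, 4 hold n, sigma, k and n/2; 5 holds the length of the
   shortest cover found so far; 6 holds a number larger than all codes; 3 and
   10 to 30 are local to the subprograms.
   Arrays: 0 and 1 are the input; 2 holds the codes of T or of its reversal;
   3 the current filling of the first half; 4 and 5 the input and output of the
   Z-algorithm; 6, 7 and 8 the P[d], the gap lengths by level and the stack;
   9 marks the shifts d for which T[0..n-d) and T[d..n) do not match; 10 tells
   which non-solid symbols share a letter with the current one. *)
Definition z_value (X : nat -> nat) (i k : nat) : Prop :=
  (forall j, j < k -> X j = X (i + j)) /\ X k <> X (i + k).

(** A copied value that ends before the known occurrence does is already final. It gets no case of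
    its own: the next comparison fails and stores it. *)
Definition z_prog : cmd := (
  15 ::= 1;; 16 ::= 0;; 17 ::= 0;; 18 ::= 0;;
  While (#15 < #14)
   (If (4@[#16] == 4@[#15 + #16]) (16 ::= #16 + 1)
     (5@[#15] ::= #16;;
      If (#18 < #15 + #16) (17 ::= #15;; 18 ::= #15 + #16) Skip;;
      15 ::= #15 + 1;;
      If (#15 < #18)
        (16 ::= 5@[#15 - #17];; If (#18 - #15 < #16) (16 ::= #18 - #15) Skip)
        (16 ::= 0))))%ram.

(* [zl, zr) is the known occurrence of a prefix of X that ends furthest right. An
   iteration advances [zi] or [maxn zr (zi + zk)], whence the bound [z_m]. *)
Record z_inv (N : nat) (X : nat -> nat) (m : nat) (s : state) : Prop := ZInv {
  zi : nat; zk : nat; zl : nat; zr : nat;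
  z15 : regs s 15 = zi; z16 : regs s 16 = zk; z17 : regs s 17 = zl; z18 : regs s 18 = zr;
  zX : forall j, arrays s 4 j = X j;
  z_m : m = (N - zi) + (N - maxn zr (zi + zk));
  z_i : 0 < zi <= N;
  z_Z : forall j, 0 < j < zi -> z_value X j (arrays s 5 j);
  z_k : forall j, j < zk -> X j = X (zi + j);
  z_l : zl < zi; z_l0 : zl = 0 -> zr = 0; z_r : zr < N;
  z_lr : forall j, zl <= j < zr -> X j = X (j - zl);
  z_ik : zi < N -> zi + zk < N;
  z_ne : zi < N -> zi + zk < zr -> X zk <> X (zi + zk) }.

(** The last cell differs from all others, so no comparison of two distinct cells succeeds there and
    the program needs no bounds test. *)
Lemma z_progP w s N :
  0 < w -> 2 * N + 2 < 2 ^ w -> 1 < N -> regs s 14 = N ->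
  (forall j, j < N.-1 -> arrays s 4 j <> arrays s 4 N.-1) ->
  wp w z_prog s (fun t s' => t <= 200 * N /\
    forall i, 0 < i < N -> z_value (arrays s 4) i (arrays s' 5 i)).
Proof.
move=> w0 HW N1 E14 Hlast.
set X := arrays s 4.
rewrite /z_prog; steps.
apply: (@wp_while _ (z_inv N X) 60 _ _ _ _ ((N - 1) + (N - 1))).
- by exists 1 0 0 0 => //= *; lia.
- move=> m1 s1 F1 [i k l r E15 E16 E17 E18 EX Em i0 HZ Hk Hl Hl0 Hr Hlr Hik Hne].
  have E14' : regs s1 14 = N by case: F1 => ->.
  ev; rewrite eqb0 negbK => lt_iN.
  have lt_ik := Hik lt_iN.
  apply: wp_if.
  - by ev; rewrite !EX.
  - move=> /eqP Ek; steps; split; first by lia.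
    have lt2 : i + k < N.-1.
      case: (eqVneq (i + k) N.-1) => [E|]; last by lia.
      by case: (Hlast k); [lia|rewrite -/X Ek E].
    (* By [z_ne] a comparison inside the known occurrence always fails. A success therefore happens
       at or beyond [r] and advances [maxn zr (zi + zk)]. *)
    have ge_r : r <= i + k by case: leqP => // lt; case: (Hne lt_iN lt).
    exists ((N - i) + (N - (i + k).+1)); first by rewrite Em; lia.
    exists i (k.+1) l r => //=; try lia.
    move=> j; rewrite ltnS leq_eqVlt => /orP [/eqP ->//|]; exact: Hk.
  - move=> /eqP nEk; steps.
    set s2 := set_cell s1 5 i k.
    have [F15 F16 F17 F18] : [/\ regs s2 15 = i, regs s2 16 = k, regs s2 17 = l & regs s2 18 = r].
      by split.
    have HZ2 j : 0 < j < i.+1 -> z_value X j (arrays s2 5 j).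
      move=> Hj; rewrite /s2 /=; case: eqP => [->//|nj]; apply: HZ; lia.
    apply: (@wp_conseq _ _ _ (fun t s' => t <= 12 /\ exists l' r',
       [/\ regs s' 17 = l', regs s' 18 = r',
          [/\ l' < i.+1, l' = 0 -> r' = 0 & r' < N],
          forall j, l' <= j < r' -> X j = X (j - l') & r' = maxn r (i + k)])).
      ifs => [lt|ge]; steps; (split; first lia).
        exists i, (i + k); split=> //; [by split=> //; lia | | by lia].
        by move=> j Hj; rewrite (Hk (j - i)); [congr X|]; lia.
      by exists l, r; split=> //; [split=> //|]; lia.
    move=> t1 s3 F3 [Ht1 [l' [r' [E17' E18' [Hl' Hl0' Hr'] Hlr' Er']]]].
    have E15' : regs s3 15 = i by case: F3 => ->.
    have A3 a j : arrays s3 a j = arrays s2 a j by case: F3 => _ ->.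
    steps; ifs => [lt|ge].
    (* [l' = 0] would mean that no occurrence is known yet. Positivity puts [i + 1 - l'] among the
       cells whose value is already computed. *)
    - have l'0 : 0 < l' by lia.
      steps.
      set q := arrays s3 5 _.
      have Hi : 0 < i + 1 - l' < i.+1 by lia.
      have [Hq nq] : z_value X (i + 1 - l') q by rewrite /q A3; apply: HZ2.
      have EX3 j : arrays s3 4 j = X j by rewrite A3 /s2 /= EX.
      have Z3 j : 0 < j < i.+1 -> z_value X j (arrays s3 5 j) by rewrite A3; apply: HZ2.
      have HXX d : i + 1 + d < r' -> X (i + 1 + d) = X (i + 1 - l' + d).
        by move=> Hd; rewrite Hlr'; [congr X|]; lia.
      (* A value reaching past [r'] is cut to end there, which makes [z_ne] vacuous. Otherwise the
         mismatch known for the copied value is transported into the occurrence. *)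
      ifs => [lt2|ge2]; steps; (split; first lia).
      + exists ((N - i.+1) + (N - r')); first by lia.
        exists (i.+1) (r' - i.+1) l' r' => //=; try lia.
        by move=> j Hj; rewrite (_ : i.+1 + j = i + 1 + j) ?HXX; [apply: Hq|..]; lia.
      + exists ((N - i.+1) + (N - r')); first by lia.
        exists (i.+1) q l' r' => //=; try lia.
        by move=> j Hj; rewrite (_ : i.+1 + j = i + 1 + j) ?HXX; [apply: Hq|..]; lia.
        by move=> _ Hj; rewrite (_ : i.+1 + q = i + 1 + q) ?HXX //; lia.
    - steps; have EX3 j : arrays s3 4 j = X j by rewrite A3 /s2 /= EX.
      have Z3 j : 0 < j < i.+1 -> z_value X j (arrays s3 5 j) by rewrite A3; apply: HZ2.
      split; first lia.
      exists ((N - i.+1) + (N - maxn r' i.+1)); first by lia.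
      by exists (i.+1) 0 l' r' => //=; lia.
- move=> t m2 s2 F2 [i k l r E15 E16 E17 E18 EX Em i0 HZ Hk Hl Hl0 Hr Hlr Hik Hne].
  have E14' : regs s2 14 = N by case: F2 => ->.
  ev => /eqP; rewrite eqb0 -leqNgt => ge_iN Ht; split; first by lia.
  by move=> j Hj; apply: HZ; lia.
Qed.

Definition lcp_spec (f : nat -> nat) (v : nat) (g : nat -> nat) (u k : nat) : Prop :=
  [/\ k <= v, k <= u, forall j, j < k -> f j = g j & k < v -> k < u -> f k <> g k].

(* The Z-algorithm on V sep W sep', where V has length #11 and starts at cell #10
   of array [a1], and W is the prefix of length #12 of array [a2]. Afterwards
   5@[#19 + y] is the length of the longest common prefix of V and W[y..]. *)
Definition lcp_prog (a1 a2 : nat) : cmd := (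
  For 13 11 (4@[#13] ::= a1@[#10 + #13]);;
  4@[#11] ::= #6;;
  19 ::= #11 + 1;;
  For 13 12 (4@[#19 + #13] ::= a2@[#13]);;
  14 ::= #19 + #12;;
  4@[#14] ::= #6 + 1;;
  14 ::= #14 + 1;;
  z_prog)%ram.

Lemma sum_cst (N c : nat) : \sum_(i < N) c = N * c.
Proof. by rewrite sum_nat_const card_ord. Qed.

(** Both separators exceed every code and they differ from each other, so no common prefix runs past
    the end of V or of W; the second one is also the unique last cell that the Z-algorithm requires.
    The value [y = wl] is allowed because callers look one cell past a position that may be the
    last. *)
Lemma lcp_progP w s a1 a2 n off v wl sep :
  0 < w -> 20 * n + 20 <= 2 ^ w -> 0 < n ->
  regs s 10 = off -> regs s 11 = v -> regs s 12 = wl -> regs s 6 = sep ->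
  v <= n -> wl <= n -> off <= n -> sep <= 2 * n ->
  a1 \notin [:: 4; 5] -> a2 \notin [:: 4; 5] ->
  (forall i, i < v -> arrays s a1 (off + i) < sep) ->
  (forall i, i < wl -> arrays s a2 i < sep) ->
  wp w (lcp_prog a1 a2) s (fun t s' =>
    [/\ t <= 1000 * n, regs s' 19 = v.+1 &
      forall y, y <= wl -> lcp_spec (fun i => arrays s a1 (off + i)) v
        (fun i => arrays s a2 (y + i)) (wl - y) (arrays s' 5 (v.+1 + y))]).
Proof.
move=> w0 HW n0 E10 E11 E12 E6 le_v le_wl le_off le_sep; rewrite !inE !negb_or.
move=> /andP [a14 a15] /andP [a24 a25] H1 H2.
rewrite /lcp_prog; steps.
apply: (@wp_for _ (fun i s1 => forall j, j < i ->
  arrays s1 4 j = arrays s a1 (off + j)) (fun=> 10)) => //.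
  by rewrite E11; lia.
- move=> i s1; rewrite E11 => lt_i F Er IH.
  have E10' : regs s1 10 = off by case: F => ->.
  have A1 j : arrays s1 a1 j = arrays s a1 j by case: F => _ -> //; rewrite /= inE.
  steps; split; first lia.
  move=> s3 _ -> j; rewrite ltnS /= A1.
  case: eqP => [->//|ne] le; apply: IH; lia.
move=> t1 s1 F1; rewrite E11 sum_cst => X1 Ht1.
have [E10' E11' E12' E6'] :
  [/\ regs s1 10 = off, regs s1 11 = v, regs s1 12 = wl & regs s1 6 = sep].
  by case: F1 => F _; rewrite !F.
steps.
set s1' := set_reg _ _ _.
have A1' j : arrays s1' a2 j = arrays s a2 j.
  by rewrite /s1' /= (negbTE a24) /=; case: F1 => _ ->; rewrite //= inE.
apply: (@wp_for _ (fun i s2 => [/\ forall j, j < v -> arrays s2 4 j = arrays s a1 (off + j),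
  arrays s2 4 v = sep &
  forall j, j < i -> arrays s2 4 (v + 1 + j) = arrays s a2 j]) (fun=> 10)) => //.
- by rewrite /= E12'; lia.
- move=> s2 F2 -> _ _; split=> // [j lt_j|]; rewrite /s1' /= ?eqxx //.
  by rewrite ltn_eqF // X1.
- move=> i s2; rewrite /= E12' => lt_i F2 Er [I1 I2 I3].
  have A2 j : arrays s2 a2 j = arrays s a2 j.
    by case: F2 => _ ->; rewrite ?A1' //= inE.
  have E19 : regs s2 19 = v + 1 by case: F2 => ->.
  steps; split; first by lia.
  move=> s3 _ ->; split=> [j lt_j||j]; rewrite /= ?A2.
  - by rewrite ifF ?I1 //; lia.
  - by rewrite ifF ?I2 //; lia.
  - rewrite eqn_add2l; case: eqP => [->//|ne] le; apply: I3; lia.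
move=> t2 s2 F2; rewrite /= E12' sum_cst => -[I1 I2 I3] Ht2.
have [G12 G6 G19] : [/\ regs s2 12 = wl, regs s2 6 = sep & regs s2 19 = v + 1].
  by case: F2 => F _; rewrite !F.
steps.
set s3 := set_reg _ _ _.
have Y1 j : j < v -> arrays s3 4 j = arrays s a1 (off + j).
  by move=> lt_j; rewrite /s3 /= ifF ?I1 //; lia.
have Y2 : arrays s3 4 v = sep by rewrite /s3 /= ifF ?I2 //; lia.
have Y3 j : j < wl -> arrays s3 4 (v + 1 + j) = arrays s a2 j.
  by move=> lt_j; rewrite /s3 /= ifF ?I3 //; lia.
have Y4 : arrays s3 4 (v + 1 + wl) = sep + 1 by rewrite /s3 /= eqxx.
have Y5 j : j < v + 1 + wl -> arrays s3 4 j < sep + 1.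
  move=> lt_j; case: (ltngtP j v) => [lt|gt|->]; last by rewrite Y2; lia.
    by rewrite Y1 //; have := H1 j lt; lia.
  rewrite (_ : j = v + 1 + (j - v - 1)); last by lia.
  by rewrite Y3; [have := H2 (j - v - 1)|]; lia.
apply: (wp_conseq (z_progP (N := v + 1 + wl + 1) w0 _ _ _ _)).
- by lia.
- by lia.
- by rewrite /s3 /=.
- move=> j; rewrite (_ : (v + 1 + wl + 1).-1 = v + 1 + wl); last by lia.
  by move=> lt_j; rewrite Y4; have := Y5 j lt_j; lia.
move=> t s4 F4 [Ht HZ]; split; first by lia.
  by case: F4 => -> // _; rewrite /s3 /= G19 addn1.
move=> y le_y; have /HZ [Z1 Z2] : 0 < v.+1 + y < v + 1 + wl + 1 by lia.
set k := arrays s4 5 _ in Z1 Z2 *.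
have le_kv : k <= v.
  case: leqP => // lt; have := Z1 v lt; rewrite Y2.
  case: (ltngtP (y + v) wl) => [l|g|E].
  - rewrite (_ : v.+1 + y + v = v + 1 + (y + v)) ?Y3 //; last by lia.
    by have := H2 _ l; lia.
  - have := Z1 (wl - y); case: (ltngtP (wl - y) v) => [l2|//|E2]; try by lia.
    rewrite (_ : v.+1 + y + (wl - y) = v + 1 + wl) ?Y4; last by lia.
    by rewrite Y1 //; have := H1 _ l2; lia.
  - by rewrite (_ : v.+1 + y + v = v + 1 + wl) ?Y4; lia.
have le_ku : k <= wl - y.
  case: leqP => // lt; have := Z1 _ lt.
  rewrite (_ : v.+1 + y + (wl - y) = v + 1 + wl) ?Y4; last by lia.
  by have := Y5 (wl - y); lia.
split=> // [j lt_j|lt1 lt2].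
  rewrite -(Y1 j); last by lia.
  rewrite (Z1 j lt_j) -(Y3 (y + j)); last by lia.
  by congr (arrays s3 4 _); lia.
move: Z2; rewrite (Y1 k) // (_ : v.+1 + y + k = v + 1 + (y + k)); last by lia.
by rewrite (Y3 (y + k)); last by lia.
Qed.

Lemma lcp_spec_ext f v g u k f' g' :
  (forall i, i < v -> f i = f' i) -> (forall i, i < u -> g i = g' i) ->
  lcp_spec f v g u k -> lcp_spec f' v g' u k.
Proof.
move=> Ef Eg [le_v le_u H1 H2]; split=> // [j lt_j|l1 l2].
  by rewrite -Ef -?Eg ?H1 //; apply: leq_trans lt_j _.
by rewrite -Ef -?Eg //; apply: H2.
Qed.

(** * Occurrences of the prefixes of a filling *)

Definition has_letter (sg : nat) (b : nat -> nat) (c x : nat) : bool :=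
  if c < sg then x == c else b ((c - sg) * sg + x) != 0.

Definition match_prog : cmd := (
  10 ::= 0;; 11 ::= #4;; 12 ::= #0;; lcp_prog 3 2;;
  For 20 0 (6@[#20] ::= 5@[#19 + #20]);;
  For 20 0
   (If (2@[#20] < #1) Skip
     (10 ::= #20 + 1;; 11 ::= #0 - #10;; 12 ::= #4;; lcp_prog 2 3;;
      22 ::= (2@[#20] - #1) * #1;;
      23 ::= #20 + 1;;
      For 21 23
       (24 ::= #20 - #21;;
        If (6@[#21] == #24)
          (If (#24 < #4)
             (If (1@[#22 + 3@[#24]]) (6@[#21] ::= (#24 + 1) + 5@[#19 + (#24 + 1)])
                Skip) Skip) Skip))))%ram.

Section Machine.
Variables (w n sg k h : nat) (a b : nat -> nat).

(** [par_W] leaves room for the lengths and separators of the Z-algorithm, [par_W2] for addresses in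
    the array of bit vectors. *)
Record params : Prop := Params {
  par_w : 0 < w;
  par_W : 20 * n + 20 <= 2 ^ w;
  par_W2 : n * n + n <= 2 ^ w;
  par_n : 1 < n;
  par_sg : 1 < sg <= n;
  par_k : k <= n;
  par_h : 2 * h <= n <= 2 * h + 1;
  par_a : forall i, i < n -> a i < sg + k;
  par_nk : \sum_(i < n) (sg <= a i) = k }.

Record env (s : state) : Prop := Env {
  env0 : regs s 0 = n;
  env1 : regs s 1 = sg;
  env2 : regs s 2 = k;
  env4 : regs s 4 = h;
  env6 : regs s 6 = sg + n;
  env_a : forall i, i < n -> arrays s 2 i = a i;
  env_b : forall i, arrays s 1 i = b i }.

Lemma env_frame rs az s s' :
  all (fun r => r \notin rs) [:: 0; 1; 2; 4; 6] ->
  all (fun r => r \notin az) [:: 1; 2] ->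
  frame rs az s s' -> env s -> env s'.
Proof.
move=> /= /and5P [r0 r1 r2 r4 /andP [r6 _]] /and3P [a1 a2 _] [Fr Fa].
by case=> *; split=> *; rewrite ?Fr ?Fa //; auto.
Qed.

Hypothesis Par : params.

Section Match.
Variable S : nat -> nat.
Hypothesis S_lt : forall x, x < h -> S x < sg.

(* Non-solid positions of T from [p] on count as mismatches. *)
Definition match_at (p d x : nat) : bool :=
  has_letter sg b (a (d + x)) (S x) && ((a (d + x) < sg) || (d + x < p)).

Definition match_upto (p d l : nat) : Prop :=
  [/\ l <= h, d + l <= n, forall x, x < l -> match_at p d x &
      l < h -> d + l < n -> ~~ match_at p d l].

(** The code of a non-solid position is at least [sg] and never equals a letter of [S], so equality
    of codes is exactly matching with all non-solid positions forbidden. *)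
Lemma match_upto0 d l : d < n ->
  lcp_spec S h (fun i => a (d + i)) (n - d) l -> match_upto 0 d l.
Proof.
move=> lt_d [l1 l2 H1 H2]; split=> // [|x lt_x|lt1 lt2]; first by lia.
  have Ex := H1 _ lt_x; have := S_lt (leq_trans lt_x l1).
  by rewrite /match_at /has_letter -Ex => -> /=; rewrite eqxx.
have := H2 lt1; have -> : l < n - d by lia.
move=> /(_ isT) /eqP ne; rewrite /match_at /has_letter ltn0 orbF.
by case: ifP; rewrite ?andbF // (negbTE ne).
Qed.

(** Releasing position [p] matters only if the match at [d] stopped exactly at [p], a non-solid
    position, and [p] accepts the letter of [S] there. The disjunction lists the ways in which this
    fails. *)
Lemma match_upto_step p d l :
  (p < d + l \/ d + l < p \/ a p < sg \/ p < d \/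
    (l < h -> ~~ has_letter sg b (a (d + l)) (S l))) ->
  match_upto p d l -> match_upto p.+1 d l.
Proof.
move=> Hp [l1 l2 H1 H2]; split=> // [x lt_x|lt1 lt2].
  have := H1 _ lt_x; rewrite /match_at => /andP [-> /orP [->//|lt]] /=.
  by rewrite ltnS (ltnW lt) orbT.
have := H2 lt1 lt2; rewrite /match_at !negb_and => /orP [->//|].
rewrite !negb_or => /andP [H3 H4].
case: (ltngtP (d + l) p) => [lt|gt|E].
- by rewrite lt in H4.
- by apply/orP; right; rewrite H3; lia.
case: Hp => [|[|[|[|H]]]]; last by rewrite (H lt1).
all: by rewrite -?E in H3 *; lia.
Qed.

(** Behind [p], non-solid positions still count as mismatches, so the extended match goes on as long
    as codes and letters are equal: one longest common prefix. *)
Lemma match_upto_jump p d l e : p < n -> d + l = p -> l < h ->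
  has_letter sg b (a p) (S l) ->
  lcp_spec (fun i => a (p.+1 + i)) (n - p.+1) (fun i => S (l.+1 + i)) (h - l.+1) e ->
  match_upto p d l -> match_upto p.+1 d (l.+1 + e).
Proof.
move=> lt_p Ep lt_l Hh [e1 e2 E1 E2] [l1 l2 H1 H2]; split; try lia.
- move=> x; case: (ltngtP x l) => [lt _|gt lt|-> _].
  + have := H1 _ lt; rewrite /match_at => /andP [-> /orP [->//|lt']] /=.
    by rewrite ltnS (ltnW lt') orbT.
  + have := E1 (x - l.+1); rewrite (_ : p.+1 + _ = d + x); last by lia.
    rewrite subnKC // => Ex; rewrite /match_at /has_letter Ex; last by lia.
    by rewrite S_lt ?eqxx; lia.
  + by rewrite /match_at Ep Hh ltnSn orbT.
move=> lt1 lt2; rewrite /match_at /has_letter.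
rewrite (_ : d + (l.+1 + e) = p.+1 + e); last by lia.
have -> : p.+1 + e < p.+1 = false by lia.
rewrite orbF; case: ifP; rewrite ?andbF ?andbT // => _.
by apply/eqP => E; apply: E2; [lia|lia|rewrite E].
Qed.

(** Non-solid positions are released from left to right. After one run of the Z-algorithm for [p],
    each shift [d <= p] is updated in constant time, and shifts beyond [p] do not see it. *)
Lemma match_progP s : env s -> (forall x, x < h -> arrays s 3 x = S x) ->
  wp w match_prog s (fun t s' => t <= 1500 * (n * k.+1) /\
     forall d, d < n -> match_upto n d (arrays s' 6 d)).
Proof.
move=> Es ES; case: (Par) => w0 HW HW2 n1 sgP kn hn Ha Hnk.
case: (Es) => E0 E1 E2 E4 E6 EA EB.
rewrite /match_prog; steps.
apply: (wp_conseq (lcp_progP (n := n) (off := 0) (v := h) (wl := n) (sep := sg + n)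
  w0 HW _ _ _ _ _ _ _ _ _ _ _ _ _)) => //=; try lia.
- by move=> i lt_i; rewrite add0n ES //; have := S_lt lt_i; lia.
- by move=> i lt_i; rewrite EA //; have := Ha _ lt_i; lia.
move=> t1 s1 F1 [Ht1 E19 H1].
have G1 : env s1 by apply: env_frame F1 _ => //; split.
have ES1 : forall x, x < h -> arrays s1 3 x = S x by case: F1 => _ F x lt_x; rewrite F ?ES.
have {}H1 d : d < n -> match_upto 0 d (arrays s1 5 (h.+1 + d)).
  move=> lt_d; apply: match_upto0 => //.
  apply: lcp_spec_ext (H1 d (ltnW lt_d)) => i lt_i; first by rewrite add0n ES.
  by rewrite EA //; lia.
case: (G1) => {E0 E1 E2 E4 E6 EA EB} E0 E1 E2 E4 E6 EA EB.
steps.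
apply: (@wp_for _ (fun i s2 => forall d, d < i -> match_upto 0 d (arrays s2 6 d)) (fun=> 10)) => //.
  by rewrite E0; lia.
  move=> i s2; rewrite E0 => lt_i F2 Er IH.
  have E19' : regs s2 19 = h.+1 by case: F2 => ->.
  have A5 j : arrays s2 5 j = arrays s1 5 j by case: F2 => _ ->.
  steps; split; first lia.
  move=> s3 _ -> d; rewrite ltnS /=.
  case: eqP => [->//|ne] le; first by rewrite A5; apply: H1.
  by apply: IH; lia.
move=> t2 s2 F2; rewrite E0 sum_cst => {}H1 Ht2.
have G2 : env s2 by apply: env_frame F2 _.
have ES2 : forall x, x < h -> arrays s2 3 x = S x by case: F2 => _ F x lt_x; rewrite F ?ES1.
case: (G2) => {E0 E1 E2 E4 E6 EA EB E19} E0 E1 E2 E4 E6 EA EB.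
apply: (@wp_for _ (fun p s3 => forall d, d < n -> match_upto p d (arrays s3 6 d))
   (fun p => 60 + (sg <= a p) * (1200 * n))) => //.
- by rewrite E0; lia.
- by move=> s3 _ -> _ _ d; apply: H1.
- move=> p s3; rewrite E0 => lt_p F3 Er IH.
  have G3 : env s3 by apply: env_frame F3 _.
  have ES3 : forall x, x < h -> arrays s3 3 x = S x by case: F3 => _ F x lt_x; rewrite F ?ES2.
  case: (G3) => {E0 E1 E2 E4 E6 EA EB} E0 E1 E2 E4 E6 EA EB.
  ifs => [lt|ge].
    steps; split; first lia.
    move=> s4 _ -> d lt_d; apply: match_upto_step (IH d lt_d).
    by right; right; left; rewrite -EA.
  have Eap : arrays s3 2 p = a p by rewrite EA.
  have Hap := Ha p lt_p.
  have mul_le : (a p - sg) * sg + sg <= n * n.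
    by rewrite -mulSnr; apply: leq_mul; lia.
  rewrite Eap in ge.
  steps.
  apply: (wp_conseq (lcp_progP (n := n) (off := p + 1) (v := n - (p + 1)) (wl := h)
    (sep := sg + n) w0 HW _ _ _ _ _ _ _ _ _ _ _ _ _)) => //=; try lia.
  - by move=> i lt_i; rewrite EA; [have := Ha (p + 1 + i)|]; lia.
  - by move=> i lt_i; rewrite ES3 //; have := S_lt lt_i; lia.
  move=> t3 s4 F4 [Ht3 E19 HL].
  have {}HL l : l < h -> lcp_spec (fun i => a (p.+1 + i)) (n - p.+1)
      (fun i => S (l.+1 + i)) (h - l.+1) (arrays s4 5 ((n - (p + 1)).+1 + l.+1)).
    move=> lt_l; have := HL _ lt_l; rewrite addn1 => {}HL.
    apply: lcp_spec_ext HL => i lt_i; first by rewrite EA //; lia.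
    by rewrite ES3 //; lia.
  have G4 : env s4 by apply: env_frame F4 _ => //; split.
  have ES4 : forall x, x < h -> arrays s4 3 x = S x by case: F4 => _ F x lt_x; rewrite F ?ES3.
  have P4 d : arrays s4 6 d = arrays s3 6 d by case: F4 => _ ->.
  have Er4 : regs s4 20 = p by case: F4 => ->.
  have E20 : arrays s4 2 p = a p by case: F4 => _ ->.
  case: (G4) => {E0 E1 E2 E4 E6 EA EB} E0 E1 E2 E4 E6 EA EB.
  steps.
  set s4' := set_reg (set_reg _ _ _) _ _.
  apply: (@wp_for _ (fun i s5 => (forall d, d < i -> match_upto p.+1 d (arrays s5 6 d)) /\
     (forall d, i <= d < n -> match_upto p d (arrays s5 6 d))) (fun=> 60)) => //.
  - by rewrite /= ; lia.
  - move=> s5 _ -> _ _; split=> // d lt_d; rewrite /s4' /= P4; apply: IH; lia.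
  - move=> d s5; rewrite {1}/s4' /= => lt_d F5 Er5 [I1 I2].
    have [D19 D20 D22 D23] : [/\ regs s5 19 = (n - (p + 1)).+1, regs s5 20 = p,
       regs s5 22 = (a p - sg) * sg & regs s5 4 = h].
      by case: F5 => F _; rewrite !F.
    have M0 := I2 d; set l := p - d; set q := arrays s5 6 d in M0.
    have Eq : arrays s5 6 d = q by [].
    have Al : l < h -> arrays s5 3 l = S l.
      by move=> lt_l; case: F5 => _ -> //; apply: ES4.
    have A5 j : arrays s5 5 j = arrays s4 5 j by case: F5 => _ ->.
    have A1 j : arrays s5 1 j = b j by case: F5 => _ ->; rewrite // /s4' /=.
    have keep (f : nat -> nat) t : t <= 60 -> match_upto p.+1 d q -> t <= 60 /\ (forall s6 : state,
       (forall r', r' != 21 -> regs s6 r' = f r') -> arrays s6 = arrays s5 ->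
       (forall d0, d0 < d.+1 -> match_upto p.+1 d0 (arrays s6 6 d0)) /\
       (forall d0, d < d0 < n -> match_upto p d0 (arrays s6 6 d0))).
      move=> Ht Hq; split=> // s6 _ ->; split=> d0 Hd0; last by apply: I2; lia.
      case: (eqVneq d0 d) => [->//|ne]; apply: I1; lia.
    steps; ifs => [/eqP Eql|neq].
      ifs => [lt_l|ge_l].
        rewrite -/l in Eql lt_l *; have Sl : S l < sg := S_lt lt_l.
        have {}Al : arrays s5 3 l = S l := Al lt_l.
        have Hl : has_letter sg b (a p) (S l) = (b ((a p - sg) * sg + S l) != 0).
          by rewrite /has_letter (negbTE ge).
        have dl : d + l = p by lia.
        rewrite Eql in M0 keep.
        set e := arrays s4 5 ((n - (p + 1)).+1 + l.+1).
        have {}HL : lcp_spec (fun i => a (p.+1 + i)) (n - p.+1)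
            (fun i => S (l.+1 + i)) (h - l.+1) e.
          exact: HL.
        have He : arrays s5 5 ((n - (p + 1)).+1 + (l + 1)) = e by rewrite A5 (addn1 l).
        have le_e : e <= n by case: HL => + _ _ _; lia.
        apply: wp_if_neq0; ev; rewrite A1 => Hb; steps.
        + split; first lia.
          move=> s6 _ ->; split=> d0 Hd0 /=; last by rewrite ifF; [apply: I2|]; lia.
          case: eqP => [->|ne]; last by apply: I1; lia.
          rewrite addn1; apply: (match_upto_jump lt_p dl lt_l _ HL); first by rewrite Hl.
          by apply: M0; lia.
        + apply: keep; first lia.
          apply: (match_upto_step (p := p)); last by apply: M0; lia.
          by do 4 right; rewrite dl Hl Hb.
      steps; apply: keep; first lia.
      apply: (match_upto_step (p := p)); last by apply: M0; lia.
      by do 4 right; lia.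
    steps; apply: keep; first lia.
    apply: (match_upto_step (p := p)); last by apply: M0; lia.
    lia.
  move=> t4 s5 F5; rewrite {1 2}/s4' /= sum_cst => -[I1 I2] Ht4; split.
    by have -> : sg <= a p; rewrite ?mul1n; lia.
  move=> s6 _ -> d lt_d; case: (ltnP d (p + 1)) => [|le]; first exact: I1.
  by apply: (match_upto_step (p := p)); [lia|apply: I2; lia].
move=> t3 s3 F3; rewrite E0 => I1 Ht3; split=> //.
have Esum : \sum_(i < n) (60 + (sg <= a i) * (1200 * n) + 8) = 68 * n + k * (1200 * n).
  rewrite -Hnk big_distrl /= (mulnC 68) -(sum_cst n 68) -big_split /=.
  by apply: eq_bigr => i _; lia.
rewrite Esum in Ht3; lia.
Qed.

End Match.
End Machine.

(** * Gaps between occurrences *)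

Section Gaps.
Variables (n : nat) (P : nat -> nat).

Definition covers_all (m : nat) : Prop :=
  forall i, i < n -> exists2 d, d <= i < d + m & m <= P d.

(** The program files a gap under the largest value of P strictly inside it. It is a gap for every
    level above that value, so the gaps of level [l] are bounded by the maximum of [G] below [l].
    Length 1 needs no record, as covers have positive length. *)
Definition gap_at (G : nat -> nat) (l b : nat) : Prop :=
  b <= 1 \/ exists2 v, v < l & b <= G v.

Definition gaps_complete (G : nat -> nat) (d : nat) : Prop :=
  forall b a l, a < b < d -> l <= P a -> l <= P b ->
    (forall y, a < y < b -> P y < l) -> gap_at G l (b - a).

(** The ends of the stretch need not be occurrences: a stretch without long enough matches refutes a
    cover whatever its ends are. *)
Definition gaps_sound (G : nat -> nat) (h : nat) : Prop :=
  forall v, v <= h -> 1 < G v ->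
    exists2 y, y + G v <= n & forall x, y < x < y + G v -> P x <= v.

Lemma gap_at_incr G G' l b : (forall v, G v <= G' v) -> gap_at G l b -> gap_at G' l b.
Proof. by move=> H [H1|[v v1 v2]]; [left|right; exists v => //; apply: leq_trans (H v)]. Qed.

(** If [G v > m] with [v < m], the last position before the right end of that stretch is uncovered.
    Conversely, a position lies between the last match of length [m] up to it and the next one,
    which exists because [n] is a sentinel; the recorded gap bounds their distance. *)
Lemma covers_allP G h m : P 0 <= h -> P n = h.+1 -> 0 < m <= P 0 ->
  gaps_complete G n.+1 -> gaps_sound G h ->
  covers_all m <-> (forall v, v < m -> G v <= m).
Proof.
move=> P0 Pn Hm HC HS; split=> [Hcov v lt_v|HG i lt_i].
  rewrite leqNgt; apply/negP => lt_m.
  have [||y le_y Hy] := HS v; [by lia..|].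
  have [|d Hd le_d] := Hcov (y + (G v).-1); first by lia.
  by have := Hy d; lia.
have [a [le_a Pa Ha]] : exists a, [/\ a <= i, m <= P a & forall y, a < y <= i -> P y < m].
  elim: i {lt_i} => [|i [a [le_a Pa Ha]]]; first by exists 0; split=> //; lia.
  case: (leqP m (P i.+1)) => [le|lt]; first by exists i.+1; split=> // y; lia.
  exists a; split=> // [|y Hy]; first by lia.
  by case: (eqVneq y i.+1) => [->//|ne]; apply: Ha; lia.
have Hex : exists b, (i < b) && (m <= P b) by exists n; rewrite Pn; lia.
case: (ex_minnP Hex) => b /andP [lt_b Pb] Hb.
have le_b : b <= n by apply: Hb; rewrite Pn; lia.
have Hg : gap_at G m (b - a).
  apply: HC => //; first by lia.
  move=> y Hy; case: (leqP y i) => [le|gt]; first by apply: Ha; lia.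
  by rewrite ltnNge; apply/negP => le; have := Hb y; rewrite gt le; lia.
exists a => //; case: Hg => [|[v /HG lev]]; lia.
Qed.

(** The state while [d] is being processed: [st_mid] and [st_cur] concern the positions between the
    current top and [d], all popped by now, and [st_done] the gaps that end before [d]. The bounds
    on the bottom entry are left out of [st_dom], since it stays even under larger values. *)
Record stack_inv (G st : nat -> nat) (d sp : nat) : Prop := StackInv {
  st_sp : 0 < sp <= d;
  st_0 : st 0 = 0;
  st_top : st sp.-1 < d;
  st_mono : forall i j, i < j < sp -> st i < st j;
  st_dom : forall j y, 0 < j < sp -> st j < y < d -> P y <= P (st j);
  st_btw : forall j y, j.+1 < sp -> st j < y < st j.+1 -> P y <= P (st j.+1);
  st_mid : forall y, st sp.-1 < y < d -> P y <= P d;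
  st_cur : forall a l, st sp.-1 <= a < d -> l <= P a ->
    (forall y, a < y < d -> P y < l) -> gap_at G l (d - a);
  st_done : gaps_complete G d }.

(** Let x be popped with y below it. The gap (y, d) is filed under P[x]. No gap ending at [d] starts
    strictly between y and x, because x dominates that stretch and would interrupt the gap. *)
Lemma stack_pop G G' st d sp : stack_inv G st d sp ->
  (forall v, G v <= G' v) -> d - st sp.-2 <= G' (P (st sp.-1)) ->
  1 < sp -> P (st sp.-1) <= P d -> stack_inv G' st d sp.-1.
Proof.
case: sp => [|[|q]] // [/= H1 H2 H3 H4 H5 H6 H7 H8 H9] HG HG2 _ Pd.
have H3' : st q < st q.+1 by apply: H4; lia.
split=> //=; try lia.
- by move=> i j Hij; apply: H4; lia.
- by move=> j y Hj Hy; apply: H5; lia.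
- by move=> j y Hj Hy; apply: H6; lia.
- move=> y Hy; case: (ltngtP y (st q.+1)) => [lt|gt|->//].
    by apply: leq_trans Pd; apply: H6; lia.
  by apply: H7; lia.
- move=> a l Ha Pa Hl; case: (ltngtP a (st q)) => [|gt|Ea]; first by lia.
    case: (ltnP a (st q.+1)) => [lt|ge].
      have := Hl (st q.+1); have := H6 q a; lia.
    by apply: gap_at_incr HG _; apply: H8 => //; lia.
  right; exists (P (st q.+1)); first by apply: Hl; lia.
  by rewrite Ea.
- by move=> b a l Hb Pa Pb Hl; apply: gap_at_incr HG _; apply: H9.
Qed.

(** A gap ending at [d] cannot start below the top: the top is larger than P[d] and would interrupt
    it. So [st_cur] already accounts for all gaps that end at [d], and [d] becomes done. *)
Lemma stack_push G st st' d sp : stack_inv G st d sp ->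
  (forall j, j < sp -> st' j = st j) -> st' sp = d ->
  (1 < sp -> P d < P (st sp.-1)) -> stack_inv G st' d.+1 sp.+1.
Proof.
case: sp => [|q] [/= H1 H2 H3 H4 H5 H6 H7 H8 H9] Est Ed Pd //.
have Hst j : j < q.+1 -> st j <= st q.
  by rewrite ltnS leq_eqVlt => /orP [/eqP ->//|lt]; apply/ltnW/H4; lia.
split=> //=; rewrite ?Ed //; try lia.
- by rewrite Est.
- move=> i j Hij; rewrite (Est i); last by lia.
  case: (eqVneq j q.+1) => [->|ne]; last by rewrite Est; [apply: H4|]; lia.
  by rewrite Ed; have := Hst i; lia.
- move=> j y Hj; case: (eqVneq j q.+1) => [->|ne]; first by rewrite Ed; lia.
  rewrite Est => [Hy|]; last by lia.
  case: (eqVneq y d) => [->|ne2]; last by apply: H5; lia.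
  apply: ltnW; apply: leq_trans (Pd _) _; first by lia.
  case: (eqVneq j q) => [->//|ne3]; apply: H5; first by lia.
  by have := H4 j q; lia.
- move=> j y Hj; case: (eqVneq j q) => [->|ne].
    by rewrite Est // Ed; apply: H7.
  by rewrite !Est; [apply: H6|..]; lia.
- by move=> a l Ha Pa _; left; lia.
- move=> b a l Hb Pa Pb Hl; case: (eqVneq b d) => [Eb|ne]; last by apply: H9 => //; lia.
  rewrite Eb in Hb Pb Hl *; case: (leqP (st q) a) => [le|gt]; first by apply: H8 => //; lia.
  case: q {H1 H4 H5 H6 H7 H8 Est Ed Hst} H3 Pd gt => [|q] H3 Pd gt; first by rewrite H2 in gt.
  by have := Hl (st q.+1); have := Pd isT; lia.
Qed.

Lemma stack_gap G st d sp z : stack_inv G st d sp -> 1 < sp ->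
  st sp.-2 < z < d -> P z <= P (st sp.-1).
Proof.
case: sp => [|[|q]] // [/= H1 H2 H3 H4 H5 H6 _ _ _] _ Hz.
case: (ltngtP z (st q.+1)) => [lt|gt|->//]; first by apply: H6; lia.
by apply: H5; lia.
Qed.

End Gaps.

(* The stack never loses its bottom, position 0, which acts as if P[0] were
   infinite: levels above P[0] are not inspected. P[n] is a sentinel, larger than
   all levels. When [x] is popped by [d], with [y] below it, (y, d) is a gap at
   level P[x] + 1. *)
Definition gap_prog : cmd := (
  6@[#0] ::= #4 + 1;;
  23 ::= #4 + 1;;
  For 20 23 (7@[#20] ::= 0);;
  8@[0] ::= 0;; 24 ::= 1;; 21 ::= 1;;
  While (#21 < #0 + 1)
    (If ((1 < #24) * (6@[8@[#24 - 1]] < 6@[#21] + 1))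
       (25 ::= 6@[8@[#24 - 1]];; 24 ::= #24 - 1;; 26 ::= #21 - 8@[#24 - 1];;
        If (7@[#25] < #26) (7@[#25] ::= #26) Skip)
       (8@[#24] ::= #21;; 24 ::= #24 + 1;; 21 ::= #21 + 1));;
  27 ::= 1;; 23 ::= 6@[0];;
  For 20 23
    (If (#27 < 7@[#20]) (27 ::= 7@[#20]) Skip;;
     If (#27 < (#20 + 1) + 1)
       (If (#20 + 1 < #5) (5 ::= #20 + 1) Skip) Skip))%ram.

Section Machine.
Variables (w n sg k h : nat) (a b : nat -> nat).
Hypothesis Par : params w n sg k h a.
Variable P : nat -> nat.
Hypothesis P_le : forall d, d < n -> P d <= h.
Hypothesis P_n : P n = h.+1.

(** The measure is an amortization: a push advances [gd] and costs 2 while it returns 1 through the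
    stack height; a pop costs that 1. *)
Record gap_inv (m : nat) (s : state) : Prop := GapInv {
  gd : nat; gsp : nat;
  g21 : regs s 21 = gd; g24 : regs s 24 = gsp; g_d : gd <= n.+1;
  g_m : m = 2 * (n.+1 - gd) + gsp;
  g_P : forall d, d <= n -> arrays s 6 d = P d;
  g_stack : stack_inv P (arrays s 7) (arrays s 8) gd gsp;
  g_sound : gaps_sound n P (arrays s 7) h }.

Lemma gap_progP s best :
  env n sg k h a b s -> (forall d, d < n -> arrays s 6 d = P d) ->
  regs s 5 = best -> best <= n ->
  wp w gap_prog s (fun t s' => t <= 1000 * n /\ exists best',
    [/\ regs s' 5 = best', best' <= best, best' = best \/ covers_all n P best' &
        forall m, covers_all n P m -> best' <= m]).
Proof.
move=> [E0 E1 E2 E4 E6 EA EB] EP E5 le_best; case: (Par) => w0 HW HW2 n1 sgP kn hn _ _.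
rewrite /gap_prog; steps.
apply: (@wp_for _ (fun i s1 => forall v, v < i -> arrays s1 7 v = 0) (fun=> 10)) => //.
- by rewrite /=; lia.
- move=> i s1; rewrite /= => lt_i F1 Er IH; steps; split; first lia.
  move=> s2 _ -> v /=; case: eqP => [//|ne] Hv; apply: IH; lia.
move=> t1 s1 F1; rewrite /= sum_cst => HG Ht1.
have {}EP d : d <= n -> arrays s1 6 d = P d.
  case: F1 => _ -> //= le_d; case: eqP => [->|ne]; rewrite ?P_n ?addn1 //.
  by apply: EP; lia.
have [G0 G5] : regs s1 0 = n /\ regs s1 5 = best by case: F1 => F _; rewrite !F.
steps.
apply: (@wp_while _ gap_inv 100 _ _ _ _ (2 * n + 1)).
- exists 1 1 => //=; try lia.
  + split=> //=; try lia.
    * by move=> a0 l Ha; left; lia.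
    * by move=> b0 a0 l; lia.
  + by move=> v le_v; rewrite HG //; lia.
- move=> m1 s2 F2 [d sp E21 E24 le_d Em IP IS IG].
  have G0' : regs s2 0 = n by case: F2 => ->.
  ev; rewrite eqb0 negbK addn1 => lt_d.
  have sp_d := st_sp IS.
  have Ed : arrays s2 6 d = P d by apply: IP; lia.
  have Pd : P d <= h.+1.
    by case: (eqVneq d n) => [->|ne]; rewrite ?P_n //; apply: leqW; apply: P_le; lia.
  set x := arrays s2 8 (sp - 1).
  have lt_x : x < d by rewrite /x subn1; apply: (st_top IS).
  have Ex : arrays s2 8 (sp - 1) = x by [].
  have Ex6 : arrays s2 6 x = P x by apply: IP; lia.
  have Px : P x <= h by apply: P_le; lia.
  ifs => [/andP [sp1 le_P]|neg].
    set y := arrays s2 8 (sp - 1 - 1).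
    have Ey : arrays s2 8 (sp - 1 - 1) = y by [].
    have yE : y = arrays s2 8 sp.-2 by rewrite /y; congr (arrays s2 8 _); lia.
    have xE : x = arrays s2 8 sp.-1 by rewrite /x subn1.
    have lt_y : y < x by rewrite yE xE; apply: (st_mono IS); lia.
    have gap z : y < z < d -> P z <= P x by rewrite yE xE; apply: (stack_gap IS).
    have fin G' s3 : regs s3 21 = d -> regs s3 24 = sp - 1 ->
        (forall v, arrays s3 7 v = G' v) -> arrays s3 8 = arrays s2 8 ->
        arrays s3 6 = arrays s2 6 ->
        (forall v, arrays s2 7 v <= G' v) -> d - y <= G' (P x) ->
        gaps_sound n P G' h -> exists2 m2, m2 < m1 & gap_inv m2 s3.
      move=> A1 A2 A3 A4 A5 A6 A7 A8; exists (2 * (n.+1 - d) + (sp - 1)); first by lia.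
      exists d (sp - 1) => //.
      - by move=> v le_v; rewrite A5 IP.
      - rewrite A4 subn1; apply: (stack_pop IS) => //.
        + by move=> v; rewrite A3; apply: A6.
        + by rewrite A3 -yE -xE.
        + by rewrite -xE; lia.
      - by move=> v le_v; rewrite A3; apply: A8.
    steps; ifs => [lt_g|ge_g]; steps; (split; first lia).
    - apply: (fin (fun v => if v == P x then d - y else arrays s2 7 v)) => //=.
      + by move=> v; case: eqP => // ->; lia.
      + by rewrite eqxx.
      + move=> v le_v; case: eqP => [->|ne]; last exact: IG.
        by move=> _; exists y; [lia|move=> z Hz; apply: gap; lia].
    - by apply: (fin (arrays s2 7)) => //=; lia.
  have push : 1 < sp -> P d < P (arrays s2 8 sp.-1).
    by rewrite -subn1 -/x => sp1; move: neg; rewrite sp1 /=; lia.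
  steps; split; first lia.
  exists (2 * (n - d) + sp.+1); first by lia.
  exists d.+1 sp.+1 => //=; try lia.
  apply: (stack_push IS) => //; last by rewrite eqxx.
  by move=> j Hj; case: eqP => // E; lia.
move=> t2 m2 s2 F2 [d sp E21 E24 le_d _ IP IS IG].
have [G0' G5'] : regs s2 0 = n /\ regs s2 5 = best by case: F2 => F _; rewrite !F.
ev => /eqP; rewrite eqb0 addn1 -leqNgt => ge_d Ht2.
have {le_d ge_d} Ed : d = n.+1 by lia.
have HC : gaps_complete P (arrays s2 7) n.+1 by rewrite -Ed; apply: st_done IS.
have EP0 : arrays s2 6 0 = P 0 by apply: IP.
have P0 : P 0 <= h by apply: P_le; lia.
steps.
pose J i mg bst := [/\ 0 < mg <= n,
   forall v, v < i -> arrays s2 7 v <= mg,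
   mg = 1 \/ exists2 v, v < i & mg = arrays s2 7 v,
   bst <= best /\ (bst = best \/ covers_all n P bst) &
   forall m, 0 < m <= i -> covers_all n P m -> bst <= m].
apply: (@wp_for _ (fun i s3 => J i (regs s3 27) (regs s3 5)) (fun=> 60)) => //.
- by rewrite /=; lia.
- move=> s3 _ _ _ Hr; rewrite !Hr //= G5'; split=> //; try (by left); try lia.
- move=> i s3; rewrite /= => lt_i F3 Er.
  have A7 v : arrays s3 7 v = arrays s2 7 v by case: F3 => _ ->.
  have A7i : arrays s3 7 i = arrays s2 7 i by apply: A7.
  set mg := regs s3 27; set bst := regs s3 5; case=> J1 J2 J3 [J4 J4'] J5.
  have Emg : regs s3 27 = mg by [].
  have Ebst : regs s3 5 = bst by [].
  set g := arrays s2 7 i in A7i.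
  have g_le : g <= n.
    case: (leqP g 1) => [|gt]; first by lia.
    by case: (IG i _ gt); [lia|move=> y le_y _]; rewrite -/g in le_y; lia.
  steps.
  apply: (@wp_conseq _ _ _ (fun t s4 =>
    [/\ t <= 10, regs s4 27 = maxn mg g, regs s4 5 = bst & regs s4 20 = i])).
    by ifs => lt; steps; split; lia.
  move=> t3 s4 F4 [Ht3 B27 B5 B20].
  have Hcov : covers_all n P i.+1 <-> maxn mg g <= i.+1.
    rewrite (covers_allP P0 P_n _ HC IG); last by lia.
    split=> [H|H v lt_v].
      rewrite geq_max; apply/andP; split; last by apply: H.
      by case: J3 => [->//|[v lt_v ->]]; apply: H; lia.
    by case: (eqVneq v i) => [->|ne]; [rewrite -/g|have := J2 v]; lia.
  have keep bst' : bst' <= bst -> bst' = bst \/ covers_all n P bst' ->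
      (covers_all n P i.+1 -> bst' <= i.+1) -> J i.+1 (maxn mg g) bst'.
    move=> K1 K2 K3; split; try lia.
    - move=> v Hv; case: (eqVneq v i) => [->|ne]; first by rewrite -/g; lia.
      by have := J2 v; lia.
    - case: (leqP g mg) => le.
        by case: J3 => [->|[v v1 v2]]; [left|right; exists v => //; lia].
      by right; exists i.
    - split; first by lia.
      by case: K2 => [->|]; [|right].
    - move=> m Hm; case: (eqVneq m i.+1) => [->//|ne] Cm.
      by apply: leq_trans K1 _; apply: J5 => //; lia.
  ifs => [lt_mg|ge_mg].
    have Ci : covers_all n P i.+1 by apply/Hcov; lia.
    ifs => [lt_b|ge_b]; steps; (split; first lia) => s5 Hr _; rewrite !Hr //=.
    - by rewrite B27 addn1; apply: keep; [lia|right|].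
    - by rewrite B27 B5; apply: keep; [|left|lia].
  steps; split; first lia.
  move=> s5 Hr _; rewrite !Hr // B27 B5; apply: keep; [by []|by left|].
  by move/Hcov; lia.
move=> t3 s3 F3; rewrite /= sum_cst => -[J1 J2 J3 [J4 J4'] J5] Ht3; split; first lia.
exists (regs s3 5); split=> // m Cm; apply: J5 => //.
(* Position 0 can be covered only from shift 0, so every cover length is at most P[0] and falls
   under an inspected level. *)
have [d' Hd le_m] := Cm 0 (ltnW n1); have E : d' = 0 by lia.
by rewrite E in Hd le_m; lia.
Qed.

End Machine.

(** * Enumeration of the fillings *)

Section Filling.
Variables (n sg k h : nat) (a b : nat -> nat).
Hypothesis sg1 : 1 < sg.

Definition rank (i : nat) : nat := \sum_(j < i) (sg <= a j).

Lemma rankS i : rank i.+1 = rank i + (sg <= a i).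
Proof. by rewrite /rank big_ord_recr. Qed.

Lemma rank_le i j : i <= j -> rank i <= rank j.
Proof. by move/subnKC <-; elim: (j - i) => [|d IH]; rewrite ?addn0 // addnS rankS; lia. Qed.

(** Letters that the symbol at [i] does not contain are tried as well; they are harmless, since P[0]
    then ends at or before [i]. *)
Definition filling (t i : nat) : nat :=
  if a i < sg then a i else (t %/ sg ^ rank i) %% sg.

Lemma filling_lt t i : filling t i < sg.
Proof. by rewrite /filling; case: ifP => // _; rewrite ltn_mod; lia. Qed.

Lemma filling0 i : filling 0 i = if a i < sg then a i else 0.
Proof. by rewrite /filling div0n mod0n. Qed.

(* [sg ^ rank i] divides [t.+1] iff adding 1 to [t] carries into the digit at [i]. *)
Lemma filling_succ t i (c := sg ^ rank i %| t.+1) : sg <= a i ->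
  (c && (filling t i == sg.-1) = (sg ^ rank i.+1 %| t.+1)) /\
  filling t.+1 i = (if filling t i + c == sg then 0 else filling t i + c).
Proof.
move=> ge; have D0 : 0 < sg ^ rank i by rewrite expn_gt0; lia.
have Hq := divnS t D0; rewrite -/c in Hq.
rewrite /filling !ltnNge ge /= Hq rankS ge addn1 expnSr.
set q := t %/ _ in Hq *.
have lt_q : q %% sg < sg by rewrite ltn_mod; lia.
case: (boolP c) => Hc /=; rewrite ?Hc ?(negbTE Hc) /= in Hq *.
  have -> : (sg ^ rank i * sg %| t.+1) = (sg %| q.+1).
    by rewrite -{1}(divnK Hc) mulnC dvdn_pmul2r // Hq.
  rewrite add1n modnS; have := modnS q sg; case: ifP => Hd E.
    have /eqP := E; have Eq : (q %% sg).+1 = sg.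
      have := divn_eq q sg; have := divn_eq q.+1 sg; rewrite E.
      set u := q.+1 %/ sg; set v := q %/ sg => E1 E2.
      have lt_uv : v < u by rewrite -(ltn_pmul2r (ltnW sg1)); lia.
      have : v.+1 * sg <= u * sg by rewrite leq_mul2r lt_uv orbT.
      by rewrite mulSn; lia.
    by rewrite addn1 Eq eqxx; lia.
  have ne : (q %% sg).+1 != sg.
    by have : q.+1 %% sg < sg; [rewrite ltn_mod; lia|rewrite E; lia].
  by rewrite addn1 (negbTE ne); split=> //; lia.
rewrite add0n addn0 (ltn_eqF lt_q); split=> //.
by symmetry; apply: contraNF Hc; apply: dvdn_trans; apply: dvdn_mulr.
Qed.

Lemma filling_onto s h' : (forall x, x < h' -> s x < sg) ->
  exists2 t, t < sg ^ rank h' & forall x, x < h' -> sg <= a x -> filling t x = s x.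
Proof.
elim: h' => [|h' IH] Hs; first by exists 0 => //; rewrite /rank big_ord0.
have [|t lt_t Ht] := IH; first by move=> x lt_x; apply: Hs; lia.
rewrite rankS; case: (ltnP (a h') sg) => [lt|ge].
  exists t; first by rewrite addn0.
  by move=> x Hx gx; apply: Ht => //; case: (eqVneq x h') gx => [->|]; lia.
have D0 : 0 < sg ^ rank h' by rewrite expn_gt0; lia.
(* The new letter becomes the leading digit and leaves the lower digits, those of [t], unchanged. *)
exists (s h' * sg ^ rank h' + t).
  rewrite addn1 expnS; apply: (@leq_trans (s h' * sg ^ rank h' + sg ^ rank h')).
    by rewrite ltn_add2l.
  by rewrite -mulSnr leq_mul2r (Hs h') ?orbT.
move=> x Hx gx; rewrite /filling ltnNge gx /=.
case: (eqVneq x h') => [->|ne].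
  by rewrite divnMDl // divn_small // addn0 modn_small // Hs.
have -> : sg ^ rank h' = sg ^ (rank h' - rank x.+1) * sg * sg ^ rank x.
  rewrite -expnSr -expnD; congr (sg ^ _).
  have : rank x.+1 <= rank h' by apply: rank_le; lia.
  by have := rankS x; rewrite gx; lia.
rewrite !mulnA divnMDl ?expn_gt0; last by lia.
rewrite modnMDl -[LHS]/(_ %% _).
have lt_x : x < h' by lia.
by have := Ht x lt_x gx; rewrite /filling ltnNge gx.
Qed.

(** Covers in terms of codes. The condition [d + m <= n] is explicit because [a] is total and has
    values beyond the end of T. *)
Definition solid_cover (m : nat) (s : nat -> nat) : Prop :=
  (forall x, x < m -> s x < sg) /\
  forall i, i < n -> exists2 d, d <= i < d + m &
    d + m <= n /\ forall x, x < m -> has_letter sg b (a (d + x)) (s x).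

Lemma solid_cover_ext m s s' : (forall x, x < m -> s x = s' x) ->
  solid_cover m s -> solid_cover m s'.
Proof.
move=> E [H1 H2]; split=> [x lt_x|i lt_i]; first by rewrite -E ?H1.
have [d Hd [Hn Hm]] := H2 i lt_i.
by exists d => //; split=> // x lt_x; rewrite -E ?Hm.
Qed.

(** Covering position 0 forces an occurrence at 0, so the cover agrees with T at the solid positions
    and its other letters are digits of some [t]. Digits beyond [m] are set to 0. *)
Lemma solid_cover_filling m s : m <= h -> solid_cover m s -> 0 < n ->
  exists2 t, t < sg ^ rank h & solid_cover m (filling t).
Proof.
move=> le_m Hc n0; have [H1 /(_ 0 n0) [d Hd [_ Hm]]] := Hc.
have {Hd} d0 : d = 0 by lia.
have [|t lt_t Ht] := @filling_onto (fun x => if x < m then s x else 0) h.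
  by move=> x _; case: ifP => [/H1 //|_]; lia.
exists t => //; apply: solid_cover_ext Hc => x lt_x.
case: (leqP sg (a x)) => [ge|lt].
  by rewrite Ht // ?lt_x //; lia.
by have := Hm x lt_x; rewrite d0 add0n /filling /has_letter lt => /eqP.
Qed.

Lemma covers_all_solid_cover S P m : (forall x, x < h -> S x < sg) -> 1 < n ->
  (forall d, d < n -> match_upto n sg h a b S n d (P d)) ->
  covers_all n P m <-> (m <= h /\ solid_cover m S).
Proof.
move=> HS n1 HP; split=> [Hc|[le_m [_ Hc]] i lt_i].
  have le_m : m <= h.
    have [d Hd Hm] := Hc 0 (ltnW n1); apply: leq_trans Hm _.
    by case: (HP d) => //; lia.
  split=> //; split=> [x lt_x|i lt_i]; first by apply: HS; lia.
  have [d Hd Hm] := Hc i lt_i; exists d => //.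
  have [|Q1 Q2 Q3 _] := HP d; first by lia.
  split=> [|x lt_x]; first by lia.
  by have /andP [] := Q3 x (leq_trans lt_x Hm).
have [d Hd [Hn Hm]] := Hc i lt_i; exists d => //.
have [|Q1 Q2 _ Q4] := HP d; first by lia.
rewrite leqNgt; apply/negP => lt; have := Q4; rewrite /match_at Hm //.
have -> : d + P d < n by lia.
by rewrite orbT; move=> /(_ _ isT) H; have := H (leq_trans lt le_m).
Qed.

End Filling.

(* Adds 1 to the number whose base-sigma digits are the letters at the non-solid
   positions; #29 is the carry. *)
Definition next_prog : cmd := (
  29 ::= 1;;
  For 20 4
    (If (2@[#20] < #1) Skip
       (30 ::= 3@[#20] + #29;;
        If (#30 == #1) (3@[#20] ::= 0) (3@[#20] ::= #30;; 29 ::= 0)));;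
  28 ::= 1 - #29)%ram.

Definition short_prog : cmd := (
  For 20 4 (If (2@[#20] < #1) (3@[#20] ::= 2@[#20]) (3@[#20] ::= 0));;
  28 ::= 1;;
  While #28 (match_prog;; gap_prog;; next_prog))%ram.

Section Machine.
Variables (w n sg k h : nat) (a b : nat -> nat).
Hypothesis Par : params w n sg k h a.

(** The number [t] exists only in the proof. The carry left at the end tells whether
    [sg ^ rank sg a h] divides [t.+1], which for [t] in range means that [t] was the last
    filling. *)
Lemma next_progP s t : env n sg k h a b s -> t < sg ^ rank sg a h ->
  (forall x, x < h -> arrays s 3 x = filling sg a t x) ->
  wp w next_prog s (fun tm s' => [/\ tm <= 100 * n,
    regs s' 28 = (t.+1 < sg ^ rank sg a h) &
    forall x, x < h -> arrays s' 3 x = filling sg a t.+1 x]).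
Proof.
move=> [E0 E1 E2 E4 E6 EA EB] lt_t ES; case: (Par) => w0 HW HW2 n1 sgP kn hn _ _.
have sg1 : 1 < sg by lia.
rewrite /next_prog; steps.
apply: (@wp_for _ (fun i s1 => [/\ regs s1 29 = (sg ^ rank sg a i %| t.+1),
  forall x, x < i -> arrays s1 3 x = filling sg a t.+1 x &
  forall x, i <= x < h -> arrays s1 3 x = filling sg a t x]) (fun=> 40)) => //.
- by rewrite /= E4; lia.
- move=> s1 _ -> _ Hr; rewrite Hr //= /rank big_ord0 expn0 dvd1n; split=> // x; lia.
- move=> i s1; rewrite /= E4 => lt_i F1 Er [I1 I2 I3].
  have [G1 GA] : regs s1 1 = sg /\ arrays s1 2 i = a i.
    by case: F1 => -> // ->; rewrite //= EA //; lia.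
  have Si : arrays s1 3 i = filling sg a t i by apply: I3; lia.
  have lt_S : filling sg a t i < sg by apply: filling_lt.
  ifs => [lt_a|ge_a].
    steps; split; first lia.
    move=> s3 Hr ->; rewrite Hr // I1 rankS leqNgt lt_a addn0.
    split=> // x Hx; last by apply: I3; lia.
    case: (eqVneq x i) => [->|ne]; last by apply: I2; lia.
    by rewrite Si /filling lt_a.
  have ge : sg <= a i by lia.
  have [C1 C2] := filling_succ sg1 t ge.
  set c := sg ^ rank sg a i %| t.+1 in C1 C2 I1.
  have new s3 v (e : bool) : regs s3 29 = e -> arrays s3 3 i = v ->
      (forall j, j != i -> arrays s3 3 j = arrays s1 3 j) ->
      e = (sg ^ rank sg a i.+1 %| t.+1) -> v = filling sg a t.+1 i ->
      [/\ regs s3 29 = (sg ^ rank sg a i.+1 %| t.+1),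
       forall x, x < i.+1 -> arrays s3 3 x = filling sg a t.+1 x &
       forall x, i.+1 <= x < h -> arrays s3 3 x = filling sg a t x].
    move=> Q1 Q2 Q3 Q4 Q5; split=> [|x Hx|x Hx]; first by rewrite Q1 Q4.
      case: (eqVneq x i) => [->|ne]; first by rewrite Q2 Q5.
      by rewrite Q3 //; apply: I2; lia.
    by rewrite Q3; [apply: I3|]; lia.
  have c1 : c <= 1 by case: (c).
  steps; ifs => [/eqP E|ne]; steps; (split; first lia) => s3 Hr A3.
    have cT : c by case: (c) E => //; lia.
    apply: (new _ 0 c); rewrite ?Hr ?A3 //= ?eqxx //.
    - by move=> j /negbTE ->.
    - by rewrite -C1 cT; lia.
    - by rewrite C2 E eqxx.
  apply: (new _ (filling sg a t i + c) false); rewrite ?Hr ?A3 //= ?eqxx //.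
  - by move=> j /negbTE ->.
  - rewrite -C1; case: (c) ne => //=; lia.
  - by rewrite C2 (negbTE ne).
move=> t1 s1 F1; rewrite /= E4 sum_cst => -[I1 I2 _] Ht1; steps.
split=> //; first by lia.
have D0 : 0 < sg ^ rank sg a h by rewrite expn_gt0; lia.
case: (eqVneq t.+1 (sg ^ rank sg a h)) => [->|ne].
  by rewrite dvdnn ltnn.
have lt : t.+1 < sg ^ rank sg a h by lia.
by rewrite gtnNdvd // lt.
Qed.

Definition short_inv (best m : nat) (s : state) : Prop := exists t,
  [/\ t <= sg ^ rank sg a h, m = sg ^ rank sg a h - t,
    regs s 28 = (t < sg ^ rank sg a h), env n sg k h a b s &
  [/\ t < sg ^ rank sg a h -> forall x, x < h -> arrays s 3 x = filling sg a t x,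
    regs s 5 <= best,
    regs s 5 = best \/ exists f, solid_cover n sg a b (regs s 5) f &
    forall t' m', t' < t -> m' <= h ->
      solid_cover n sg a b m' (filling sg a t') -> regs s 5 <= m']].

Lemma short_progP s best : env n sg k h a b s -> regs s 5 = best -> best <= n ->
  wp w short_prog s (fun tm s' => [/\ tm <= 3000 * (sg ^ rank sg a h * (n * k.+1)),
    regs s' 5 <= best,
    regs s' 5 = best \/ exists f, solid_cover n sg a b (regs s' 5) f &
    forall m f, m <= h -> solid_cover n sg a b m f -> regs s' 5 <= m]).
Proof.
move=> Es E5 le_best; case: (Par) => w0 HW HW2 n1 sgP kn hn Ha _.
have sg1 : 1 < sg by lia.
have D0 : 0 < sg ^ rank sg a h by rewrite expn_gt0; lia.
set D := sg ^ rank sg a h in D0 *.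
case: (Es) => E0 E1 E2 E4 E6 EA EB.
rewrite /short_prog; steps.
apply: (@wp_for _ (fun i s1 => forall x, x < i ->
  arrays s1 3 x = filling sg a 0 x) (fun=> 20)) => //.
- by rewrite E4; lia.
- move=> i s1; rewrite E4 => lt_i F1 Er IH.
  have G1 : env n sg k h a b s1 by apply: env_frame F1 _.
  have [H1 HA] := (env1 G1, env_a G1).
  have Ai : arrays s1 2 i = a i by apply: HA; lia.
  have new v : v = filling sg a 0 i -> forall x, x < i.+1 ->
      (if x == i then v else arrays s1 3 x) = filling sg a 0 x.
    by move=> -> x Hx; case: eqP => [->//|ne]; apply: IH; lia.
  by ifs => [lt|ge]; steps; (split; first lia) => s2 _ ->; apply: new;
    rewrite filling0 ?lt // (negbTE ge).
move=> t1 s1 F1; rewrite E4 sum_cst => S0 Ht1.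
have G1 : env n sg k h a b s1 by apply: env_frame F1 _.
have H5 : regs s1 5 = best by case: F1 => ->.
steps.
apply: (@wp_while _ (short_inv best) (2700 * (n * k.+1)) _ _ _ _ D).
- exists 0; rewrite -/D /= D0 H5 subn0; split=> //.
    by case: G1 => *; split.
  by split=> //; left.
- move=> m s2 F2 [t []]; rewrite -/D => le_t Em E28 G2 [ES B1 B2 B3].
  rewrite /= E28 eqb0 negbK => lt_t; have {}ES := ES lt_t.
  apply: wp_comp.
  apply: (wp_conseq (match_progP Par (S := filling sg a t) _ G2 ES)).
    by move=> x _; apply: filling_lt.
  move=> t2 s3 F3 [Ht2 HM].
  have G3 : env n sg k h a b s3 by apply: env_frame F3 G2.
  have ES3 x : x < h -> arrays s3 3 x = filling sg a t x.
    by case: F3 => _ -> // /ES.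
  have H53 : regs s3 5 = regs s2 5 by case: F3 => ->.
  (* Nothing is known about cell [n] after the matching phase; this is the sentinel that [gap_prog]
     stores there. *)
  pose P d := if d == n then h.+1 else arrays s3 6 d.
  have P_le d : d < n -> P d <= h.
    by move=> lt_d; rewrite /P ltn_eqF //; case: (HM d lt_d).
  have HMP d : d < n -> match_upto n sg h a b (filling sg a t) n d (P d).
    by move=> lt_d; rewrite /P ltn_eqF //; apply: HM.
  apply: wp_comp.
  apply: (wp_conseq (gap_progP Par P_le _ G3 _ H53 _)).
  - by rewrite /P eqxx.
  - by move=> d lt_d; rewrite /P ltn_eqF.
  - by lia.
  move=> t3 s4 F4 [Ht3 [best' [H54 C1 C2 C3]]].
  have G4 : env n sg k h a b s4 by apply: env_frame F4 G3.
  have ES4 x : x < h -> arrays s4 3 x = filling sg a t x.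
    by case: F4 => _ -> // /ES3.
  have cov m' : covers_all n P m' <-> m' <= h /\ solid_cover n sg a b m' (filling sg a t).
    by apply: covers_all_solid_cover => // x _; apply: filling_lt.
  apply: (wp_conseq (next_progP G4 lt_t ES4)) => t4 s5 F5 [Ht4 E285 ES5].
  have G5 : env n sg k h a b s5 by apply: env_frame F5 G4.
  have H55 : regs s5 5 = best' by case: F5 => -> //.
  split; first by lia.
  exists (D - t.+1); first by lia.
  exists t.+1; rewrite -/D; split=> //; split=> //; rewrite ?H55; first by lia.
    case: C2 => [->//|/cov [_ Hc]]; right; by exists (filling sg a t).
  move=> t' m' Ht' le_m' Hc; case: (eqVneq t' t) Hc => [->|ne] Hc.
    by apply: C3; apply/cov.
  by apply: leq_trans C1 _; apply: (B3 t') => //; lia.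
move=> t2 m2 s2 F2 [t []]; rewrite -/D => le_t Em E28 G2 [ES B1 B2 B3].
rewrite /= E28 => /eqP; rewrite eqb0 -leqNgt => ge_t Ht2; split=> //.
  have leX : n <= n * k.+1 by rewrite leq_pmulr.
  have leY : n * k.+1 <= D * (n * k.+1) by rewrite leq_pmull.
  have leZ : D <= D * (n * k.+1) by rewrite leq_pmulr //; lia.
  by rewrite mulnS mulnDr muln1 mulnCA in Ht2; lia.
move=> m f le_m Hc; have [|t' lt_t' Ht'] := solid_cover_filling sg1 le_m Hc; first by lia.
by apply: (B3 t') => //; rewrite -/D in lt_t'; lia.
Qed.

End Machine.

(** * Covers longer than half of T *)

Section Borders.
Variables (n sg k h : nat) (a b : nat -> nat).
Hypothesis sg1 : 1 < sg.

Definition compat (c1 c2 : nat) : bool :=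
  has (fun l => has_letter sg b c1 l && has_letter sg b c2 l) (iota 0 sg).

Lemma compatP c1 c2 :
  reflect (exists l, [/\ l < sg, has_letter sg b c1 l & has_letter sg b c2 l])
          (compat c1 c2).
Proof.
apply: (iffP hasP) => [[l]|[l [lt_l H1 H2]]].
  by rewrite mem_iota => /= lt_l /andP [H1 H2]; exists l.
by exists l; rewrite ?mem_iota //= H1 H2.
Qed.

Lemma compatC c1 c2 : compat c1 c2 = compat c2 c1.
Proof. by apply: eq_has => l; rewrite andbC. Qed.

Lemma compat_solid c1 c2 : c1 < sg -> compat c1 c2 = has_letter sg b c2 c1.
Proof.
move=> lt1; apply/compatP/idP => [[l [_]]|H].
  by rewrite {1}/has_letter lt1 => /eqP ->.
by exists c1; split=> //; rewrite /has_letter lt1 eqxx.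
Qed.

Definition shift_ok (d : nat) : Prop :=
  forall i, i + d < n -> compat (a i) (a (i + d)).

Definition dist (x y : nat) : nat := (x - y) + (y - x).

Lemma shift_ok_dist x y : shift_ok (dist x y) -> x < n -> y < n ->
  compat (a x) (a y).
Proof.
rewrite /dist => H lt_x lt_y; case: (leqP x y) => [le|lt].
  by have := H x; rewrite (_ : x + _ = y); [apply|lia].
by rewrite compatC; have := H y; rewrite (_ : y + _ = x); [apply|lia].
Qed.

(** At the end of a maximal run of equal codes, two solid positions carry different letters and
    refute the shift. A run that ends at a non-solid position decides nothing; that position has its
    own test. *)
Definition stop (x y e : nat) : bool :=
  [&& x + e < n, y + e < n, a (x + e) < sg & a (y + e) < sg].

Definition lcp_at (x y e : nat) : Prop :=
  lcp_spec (fun i => a (x + i)) (n - x) (fun i => a (y + i)) (n - y) e.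

Definition run_ok (x y : nat) : Prop := exists2 e, lcp_at x y e & ~~ stop x y e.

Lemma run_okC x y : run_ok x y -> run_ok y x.
Proof.
case=> e [l1 l2 H1 H2] Hs; exists e; last first.
  by move: Hs; rewrite /stop andbCA (andbC (a _ < _)).
by split=> // [j lt_j|e1 e2]; [rewrite H1|apply/nesym/H2].
Qed.

Lemma stop_bad x y e : lcp_at x y e -> stop x y e -> ~ shift_ok (dist x y).
Proof.
case=> _ _ _ H /and4P [lt1 lt2 s1 s2] Hok.
have := @shift_ok_dist (x + e) (y + e); rewrite /dist !subnDr.
move=> /(_ Hok lt1 lt2); rewrite compat_solid // /has_letter s2 => /eqP E.
by apply: H; [lia|lia|rewrite E].
Qed.

Hypothesis ne : forall i, i < n -> compat (a i) (a i).

(** The pairs (i, i + d) are scanned along runs of equal codes. Inside a run they are compatible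
    because no symbol is empty. Where a run ends, one of the two positions is non-solid; its test,
    with the partner on the left or on the right, gives compatibility and the next run. *)
Lemma run_ok_shift d : d < n -> run_ok 0 d ->
  (forall p y, p < n -> y < n -> sg <= a p -> dist p y = d ->
     compat (a p) (a y) /\ run_ok p.+1 y.+1) ->
  shift_ok d.
Proof.
move=> lt_d R0 Hp.
suff H i : i + d <= n -> (forall i', i' < i -> compat (a i') (a (i' + d))) /\
    exists s e, [/\ s <= i <= s + e, lcp_at s (s + d) e & ~~ stop s (s + d) e].
  by move=> i lt_i; have [|H1 _] := H i.+1; [lia|apply: H1].
elim: i => [|i IH] le_i.
  by split=> //; case: R0 => e H1 H2; exists 0, e; split=> //; lia.
have [|H1 [s [e [Hs He Hst]]]] := IH; first by lia.
have ext : compat (a i) (a (i + d)) ->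
    forall i', i' < i.+1 -> compat (a i') (a (i' + d)).
  by move=> Hc i' Hi'; case: (eqVneq i' i) => [->//|nei]; apply: H1; lia.
case: (ltnP i (s + e)) => [lt|ge].
  split; last by exists s, e; split=> //; lia.
  apply: ext; case: He => _ _ Heq _; have := Heq (i - s).
  rewrite (_ : s + (i - s) = i); last by lia.
  rewrite (_ : s + d + (i - s) = i + d); last by lia.
  by move=> <-; [apply: ne|]; lia.
have Ei : s + e = i by lia.
have [Hc HR] : compat (a i) (a (i + d)) /\ run_ok i.+1 (i.+1 + d).
  move: Hst; rewrite /stop Ei addnAC Ei; case: (ltnP (a i) sg) => [lt1|ge1].
    case: (ltnP (a (i + d)) sg) => [lt2|ge2 _]; first by lia.
    have [||||Hc HR] := Hp (i + d) i; [lia|lia|done|rewrite /dist; lia|].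
    by rewrite compatC; split=> //; apply: run_okC; rewrite addSn.
  by move=> _; rewrite addSn; apply: Hp => //; rewrite /dist; lia.
split; first exact: ext.
by case: HR => e' He' Hst'; exists i.+1, e'; split=> //; lia.
Qed.

Lemma shift_ok0 : shift_ok 0.
Proof. by move=> i; rewrite addn0; apply: ne. Qed.

Hypothesis h_half : 2 * h <= n <= 2 * h + 1.

Lemma shift_ok_cover d : d < n - h -> shift_ok d ->
  exists f, solid_cover n sg a b (n - d) f.
Proof.
move=> lt_d Hok.
pose f i := find (fun l => has_letter sg b (a i) l && has_letter sg b (a (i + d)) l) (iota 0 sg).
have fP i : i + d < n -> [/\ f i < sg, has_letter sg b (a i) (f i) &
    has_letter sg b (a (i + d)) (f i)].
  move=> /Hok Hc; have := Hc; rewrite /compat has_find size_iota => lt_f.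
  by have := nth_find 0 Hc; rewrite nth_iota // add0n => /andP [].
exists f; split=> [x lt_x|i lt_i]; first by case: (fP x); lia.
case: (ltnP i (n - d)) => [lt|ge].
  exists 0; first by lia.
  by split=> [|x lt_x]; [lia|rewrite add0n; case: (fP x); lia].
exists d; first by lia.
by split=> [|x lt_x]; [lia|rewrite addnC; case: (fP x); lia].
Qed.

Lemma cover_shift_ok m f : h < m -> solid_cover n sg a b m f -> 0 < n -> m <= n /\ shift_ok (n - m).
Proof.
move=> lt_m [H1 H2] n0; have [d0 Hd0 [Hn0 Hm0]] := H2 0 n0.
have [d1 Hd1 [Hn1 Hm1]] := H2 n.-1 ltac:(lia).
have E0 : d0 = 0 by lia.
have E1 : d1 = n - m by lia.
split; first by lia.
move=> i lt_i; have lt_im : i < m by lia.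
apply/compatP; exists (f i); split; first exact: H1.
  by have := Hm0 i lt_im; rewrite E0.
by have := Hm1 i lt_im; rewrite E1 addnC.
Qed.

End Borders.

(** * Marking the incompatible shifts *)

Definition row_prog : cmd := (
  For 21 2
    (24 ::= 0;; 25 ::= #21 * #1;;
     For 26 1
       (If (1@[#22 + #26]) (If (1@[#25 + #26]) (24 ::= 1) Skip) Skip);;
     10@[#21] ::= #24))%ram.

Definition test_prog : cmd := (
  If (2@[#21] < #1) (24 ::= 1@[#22 + 2@[#21]]) (24 ::= 10@[2@[#21] - #1]);;
  25 ::= 5@[#19 + (#21 + 1)];;
  26 ::= (#20 + 1) + #25;;
  27 ::= (#21 + 1) + #25;;
  28 ::= ((#26 < #0) * (#27 < #0)) * ((2@[#26] < #1) * (2@[#27] < #1));;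
  If #24 Skip (28 ::= 1);;
  If #28 (If (#20 < #21) (9@[#21 - #20] ::= 1) (9@[#20 - #21] ::= 1)) Skip)%ram.

Definition long_prog : cmd := (
  10 ::= 0;; 11 ::= #0;; 12 ::= #0;; lcp_prog 2 2;;
  For 20 0
    (24 ::= 5@[#19 + #20];;
     If (((#24 < #0) * (#20 + #24 < #0)) * ((2@[#24] < #1) * (2@[#20 + #24] < #1)))
       (9@[#20] ::= 1) Skip);;
  For 20 0
    (If (2@[#20] < #1) Skip
      (22 ::= (2@[#20] - #1) * #1;;
       row_prog;;
       10 ::= #20 + 1;; 11 ::= #0 - #10;; 12 ::= #0;; lcp_prog 2 2;;
       For 21 0 test_prog));;
  23 ::= #0 - #4;;
  For 20 23 (If (9@[#20]) Skip (5 ::= #0 - #20)))%ram.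

Section Machine.
Variables (w n sg k h : nat) (a b : nat -> nat).
Hypothesis Par : params w n sg k h a.
Hypothesis ne : forall i, i < n -> compat sg b (a i) (a i).

Local Notation env := (env n sg k h a b).
Local Notation compat := (compat sg b).
Local Notation shift_ok := (shift_ok n sg a b).
Local Notation run_ok := (run_ok n sg a).

Lemma mul_sg_le j : j < k -> j * sg + sg <= n * n.
Proof.
by move=> lt_j; case: Par => *; rewrite -mulSnr; apply: leq_mul; lia.
Qed.

(** Computing the whole row for [p] in advance lets each later test of a pair (p, y) run in constant
    time, whatever the symbol at y. *)
Lemma row_progP s p : env s -> p < n -> sg <= a p ->
  regs s 22 = (a p - sg) * sg ->
  wp w row_prog s (fun t s' => t <= 100 * (k * sg) + 6 /\
    forall j, j < k -> (arrays s' 10 j != 0) = compat (a p) (sg + j)).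
Proof.
move=> Es lt_p ge_p E22; case: (Par) => w0 HW HW2 n1 sgP kn hn Ha _.
have [E0 E1 E2 E4 E6 EA EB] := Es; rewrite /row_prog.
have Hp : (a p - sg) * sg + sg <= n * n by apply: mul_sg_le; have := Ha p lt_p; lia.
apply: (@wp_for _ (fun i s1 => forall j, j < i -> (arrays s1 10 j != 0) = compat (a p) (sg + j))
  (fun=> 40 + 30 * sg)) => //.
- by rewrite E2; lia.
- move=> j s1; rewrite E2 => lt_j F1 Er IH.
  have G1 : env s1 by apply: env_frame F1 _.
  have [H1 H22] : regs s1 1 = sg /\ regs s1 22 = (a p - sg) * sg.
    by split; [apply: (env1 G1)|case: F1 => ->].
  have Hj := mul_sg_le lt_j.
  steps.
  apply: (@wp_for _ (fun i s2 => regs s2 24 =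
      has (fun l => has_letter sg b (a p) l && has_letter sg b (sg + j) l)
        (iota 0 i)) (fun=> 20)) => //.
  + by rewrite /=; lia.
  + by move=> s2 _ _ _ Hr; rewrite Hr.
  + move=> l s2; rewrite /= H1 => lt_l F2 Er2 IH2.
    have [K22 K25] : regs s2 22 = (a p - sg) * sg /\ regs s2 25 = j * sg.
      by case: F2 => F _; rewrite !F.
    have KB i : arrays s2 1 i = b i by case: F2 => _ -> //; apply: (env_b G1).
    set v := has _ _ in IH2.
    have new s3 v' : v' = v || (b ((a p - sg) * sg + l) != 0) && (b (j * sg + l) != 0) ->
      regs s3 24 = v' -> forall s4, (forall r', r' != 26 -> regs s4 r' = regs s3 r') ->
         arrays s4 = arrays s3 -> regs s4 24 =
           has (fun l => has_letter sg b (a p) l && has_letter sg b (sg + j) l) (iota 0 l.+1).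
      move=> E3 E24 s4 Hr _; rewrite Hr // E24 E3 -[l.+1]addn1 iotaD has_cat -/v /= orbF.
      by rewrite /has_letter !ltnNge ge_p leq_addr /= addKn.
    apply: wp_if_neq0; ev; rewrite KB => H3; last first.
      steps; split; first lia.
      by apply: (new _ v); rewrite ?H3 ?orbF.
    apply: wp_if_neq0; ev; rewrite KB => H4; last first.
      steps; split; first lia.
      by apply: (new _ v); rewrite ?H4 ?andbF ?orbF.
    steps; split; first lia.
    by apply: (new (set_reg s2 24 1) true); rewrite ?H3 ?H4 ?orbT.
  move=> t2 s2 F2; rewrite /= H1 sum_cst => I2 Ht2.
  have K21 : regs s2 21 = j by case: F2 => ->.
  steps; split; first by lia.
  move=> s3 _ -> j' Hj' /=; case: (eqVneq j' j) => [->|nej].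
    by rewrite eqb0 negbK.
  have -> : arrays s2 10 j' = arrays s1 10 j' by case: F2 => _ ->.
  by apply: IH; lia.
move=> t s' F'; rewrite E2 sum_cst => I Ht; split=> //.
have : k * (40 + 30 * sg + 8) <= 100 * (k * sg).
  by rewrite mulnCA leq_mul2l; apply/orP; right; lia.
lia.
Qed.

Lemma test_progP s p y e q : env s -> p < n -> y < n -> sg <= a p ->
  regs s 20 = p -> regs s 21 = y -> regs s 22 = (a p - sg) * sg -> regs s 19 = q ->
  q <= n -> (forall j, j < k -> (arrays s 10 j != 0) = compat (a p) (sg + j)) ->
  arrays s 5 (q + (y + 1)) = e -> e <= n ->
  wp w test_prog s (fun t s' => t <= 80 /\ forall d, arrays s' 9 d =
    if (~~ compat (a p) (a y) || stop n sg a p.+1 y.+1 e) && (d == dist p y)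
    then 1 else arrays s 9 d).
Proof.
move=> Es lt_p lt_y ge_p E20 E21 E22 E19 le_q Hrow He le_e.
case: (Par) => w0 HW HW2 n1 sgP kn hn Ha _.
have sg1 : 1 < sg by lia.
have [E0 E1 E2 E4 E6 EA EB] := Es; rewrite /test_prog.
have Hp : (a p - sg) * sg + sg <= n * n by apply: mul_sg_le; have := Ha p lt_p; lia.
have Ay : arrays s 2 y = a y by apply: EA.
have Hay := Ha y lt_y.
apply: wp_comp.
apply: (@wp_conseq _ _ _ (fun t s1 => t <= 12 /\ (regs s1 24 != 0) = compat (a p) (a y))).
  ifs => [lt|ge]; steps; (split; first lia).
    by rewrite compatC compat_solid // EB /has_letter ltnNge ge_p.
  by rewrite Hrow; [congr compat|]; lia.
move=> t1 s1 F1 [Ht1 Hc].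
have [K20 K21 K19] : [/\ regs s1 20 = p, regs s1 21 = y & regs s1 19 = q].
  by case: F1 => F _; rewrite !F.
have G1 : env s1 by apply: env_frame F1 _.
have {}He : arrays s1 5 (q + (y + 1)) = e by case: F1 => _ ->.
have A9 d : arrays s1 9 d = arrays s 9 d by case: F1 => _ ->.
case: (G1) => {E0 E1 E2 E4 E6 EA EB} E0 E1 E2 E4 E6 EA EB.
steps.
set st := [&& _, _ & _].
(* The product evaluates all its factors, so cells beyond [n] may be read; their comparison with
   [sg] is then multiplied by 0. *)
have Est : st = stop n sg a p.+1 y.+1 e.
  rewrite /st /stop !addn1; case: (ltnP (p.+1 + e) n) => [lt1|//].
  by case: (ltnP (y.+1 + e) n) => [lt2|//]; rewrite !EA.
apply: (@wp_conseq _ _ _ (fun t s2 => t <= 6 /\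
   regs s2 28 = (~~ compat (a p) (a y) || st))).
  by apply: wp_if_neq0; ev => H; steps; (split; first lia); rewrite -Hc H.
move=> t2 s2 F2 [Ht2 H28].
have [L20 L21] : regs s2 20 = p /\ regs s2 21 = y by case: F2 => F _; rewrite !F.
have B9 d : arrays s2 9 d = arrays s 9 d by case: F2 => _ -> //=; rewrite A9.
rewrite -Est; ifs => [->|/negbTE ->].
  ifs => lt; steps; (split; first lia) => d; rewrite -B9 /dist.
    by rewrite (_ : p - y + (y - p) = y - p); last by lia.
  by rewrite (_ : p - y + (y - p) = p - y); last by lia.
by steps; split; first lia.
Qed.

(** Marks are justified at any time, whereas a missing mark certifies only the tests made so far.
    With [p = n] these are the premises of [run_ok_shift]. *)
Definition long_inv (p : nat) (bad : nat -> nat) : Prop :=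
  [/\ forall d, d < n -> bad d != 0 -> ~ shift_ok d,
      forall d, d < n -> bad d = 0 -> run_ok 0 d &
      forall p' y, p' < p -> y < n -> sg <= a p' -> bad (dist p' y) = 0 ->
        compat (a p') (a y) /\ run_ok p'.+1 y.+1].

Lemma long_progP s : env s -> (forall d, d < n -> arrays s 9 d = 0) ->
  wp w long_prog s (fun t s' =>
    [/\ t <= 1500 * (n * k.+1) + 200 * (k * (k * sg)),
      exists d, [/\ d < n - h, shift_ok d & regs s' 5 = n - d] &
      forall d, d < n - h -> shift_ok d -> regs s' 5 <= n - d]).
Proof.
move=> Es bad0; case: (Par) => w0 HW HW2 n1 sgP kn hn Ha Hnk.
have sg1 : 1 < sg by lia.
have Ha' i : i < n -> a i < sg + n by move=> /Ha; lia.
have [E0 E1 E2 E4 E6 EA EB] := Es; rewrite /long_prog; steps.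
apply: (wp_conseq (lcp_progP (n := n) (off := 0) (v := n) (wl := n) (sep := sg + n)
  w0 HW _ _ _ _ _ _ _ _ _ _ _ _ _)) => //=; try lia.
- by move=> i lt_i; rewrite add0n EA ?Ha'.
- by move=> i lt_i; rewrite EA ?Ha'.
move=> t1 s1 F1 [Ht1 E19 H1].
have G1 : env s1 by apply: env_frame F1 _ => //; split.
have {}bad0 d : d < n -> arrays s1 9 d = 0 by case: F1 => _ -> //=; apply: bad0.
have {}H1 d : d < n -> lcp_at n a 0 d (arrays s1 5 (n.+1 + d)).
  move=> lt_d; rewrite /lcp_at subn0.
  apply: lcp_spec_ext (H1 d (ltnW lt_d)) => i lt_i; first by rewrite add0n EA.
  by rewrite EA //; lia.
case: (G1) => {E0 E1 E2 E4 E6 EA EB} E0 E1 E2 E4 E6 EA EB.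
apply: wp_comp.
apply: (@wp_for _ (fun i s2 =>
   [/\ forall d, d < i -> arrays s2 9 d != 0 -> ~ shift_ok d,
     forall d, d < i -> arrays s2 9 d = 0 -> run_ok 0 d &
     forall d, i <= d < n -> arrays s2 9 d = 0]) (fun=> 40)) => //.
- by rewrite E0; lia.
- by move=> s2 _ -> _ _; split=> // d Hd; apply: bad0; lia.
- move=> d s2; rewrite E0 => lt_d F2 Er [I1 I2 I3].
  have G2 : env s2 by apply: env_frame F2 _.
  have K19 : regs s2 19 = n.+1 by case: F2 => ->.
  set e := arrays s1 5 (n.+1 + d) in H1 *.
  have He : arrays s2 5 (n.+1 + d) = e by case: F2 => _ ->.
  have HL := H1 d lt_d; rewrite -/e in HL.
  have le_e : e <= n by case: HL => + _ _ _; lia.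
  case: (G2) => {E0 E1 E2 E4 E6 EA EB} E0 E1 E2 E4 E6 EA EB.
  steps; ifs.
    case/andP => [/andP [lt1 lt2] /andP [lt3 lt4]].
    steps; split; first lia.
    move=> s3 _ ->; split=> d' Hd' /=; case: (eqVneq d' d) => [E|ned]; try lia.
    + move=> _; rewrite E; have := @stop_bad n sg a b sg1 0 d e HL.
      rewrite /dist sub0n subn0; apply; apply/and4P; split=> //.
        by rewrite -EA.
      by rewrite -EA.
    + by apply: I1; lia.
    + by apply: I2; lia.
    + by apply: I3; lia.
  move=> Hst; steps; split; first lia.
  move=> s3 _ ->; split=> d' Hd' /=; last by apply: I3; lia.
    case: (eqVneq d' d) => [->|ned]; last by apply: I1; lia.
    by rewrite I3 //; lia.
  case: (eqVneq d' d) => [->|ned]; last by apply: I2; lia.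
  move=> _; exists e => //; apply: contra Hst => /and4P [/= lt1 lt2].
  by rewrite -EA // -EA // => -> ->; rewrite lt1 lt2.
move=> t2 s2 F2; rewrite E0 sum_cst => -[I1 I2 _] Ht2.
have G2 : env s2 by apply: env_frame F2 _.
case: (G2) => {E0 E1 E2 E4 E6 EA EB E19} E0 E1 E2 E4 E6 EA EB.
apply: wp_comp.
apply: (@wp_for _ (fun p s3 => long_inv p (arrays s3 9))
   (fun p => 60 + (sg <= a p) * (1100 * n + 100 * (k * sg)))) => //.
- by rewrite E0; lia.
- by move=> s3 _ -> _ _; split.
- move=> p s3; rewrite E0 => lt_p F3 Er [J1 J2 J3].
  have G3 : env s3 by apply: env_frame F3 _.
  case: (G3) => {E0 E1 E2 E4 E6 EA EB} E0 E1 E2 E4 E6 EA EB.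
  have Eap : arrays s3 2 p = a p by rewrite EA.
  ifs => [lt|ge].
    steps; split; first lia.
    move=> s4 _ ->; split=> // p' y Hp' Hy ge'; apply: J3 => //.
    by case: (eqVneq p' p) ge' => [->|]; lia.
  have ge_p : sg <= a p by lia.
  have Hap := Ha' p lt_p.
  have Hp : (a p - sg) * sg + sg <= n * n by apply: mul_sg_le; have := Ha p lt_p; lia.
  steps.
  have G4 : env (set_reg s3 22 ((a p - sg) * sg)) by split.
  apply: (wp_conseq (row_progP G4 lt_p ge_p _)) => // t4 s4 F4 [Ht4 Hrow].
  have {}G4 : env s4 by apply: env_frame F4 G4.
  have [K20 K22] : regs s4 20 = p /\ regs s4 22 = (a p - sg) * sg.
    by case: F4 => F _; rewrite !F.
  have B4 d : arrays s4 9 d = arrays s3 9 d by case: F4 => _ ->.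
  case: (G4) => {E0 E1 E2 E4 E6 EA EB} E0 E1 E2 E4 E6 EA EB.
  steps.
  apply: (wp_conseq (lcp_progP (n := n) (off := p + 1) (v := n - (p + 1)) (wl := n)
    (sep := sg + n) w0 HW _ _ _ _ _ _ _ _ _ _ _ _ _)) => //=; try lia.
  - by move=> i lt_i; rewrite EA ?Ha' //; lia.
  - by move=> i lt_i; rewrite EA ?Ha'.
  move=> t5 s5 F5 [Ht5 E19 HL].
  have G5 : env s5 by apply: env_frame F5 _ => //; split.
  have {}HL y : y < n -> lcp_at n a p.+1 y.+1 (arrays s5 5 ((n - (p + 1)).+1 + y.+1)).
    move=> lt_y; have := HL y.+1 lt_y; rewrite addn1 => {}HL; rewrite /lcp_at.
    by apply: lcp_spec_ext HL => i lt_i; rewrite EA //; lia.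
  have [L20 L22] : regs s5 20 = p /\ regs s5 22 = (a p - sg) * sg.
    by case: F5 => F _; rewrite !F.
  have B5 d : arrays s5 9 d = arrays s3 9 d by case: F5 => _ -> //; rewrite B4.
  have {}Hrow j : j < k -> (arrays s5 10 j != 0) = compat (a p) (sg + j).
    by case: F5 => _ ->; [apply: Hrow|].
  have E50 : regs s5 0 = n := env0 G5.
  apply: (@wp_for _ (fun i s6 => long_inv p (arrays s6 9) /\
     forall y, y < i -> arrays s6 9 (dist p y) = 0 ->
        compat (a p) (a y) /\ run_ok p.+1 y.+1) (fun=> 80)) => //.
  - by rewrite E50; lia.
  - move=> s6 _ -> _ _; split=> //; split.
    + by move=> d Hd; rewrite B5; apply: J1.
    + by move=> d Hd; rewrite B5; apply: J2.
    + by move=> p' y H2 H3 H4; rewrite B5; apply: J3.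
  - move=> y s6; rewrite E50 => lt_y F6 Er6 [[K1 K2 K3] K4].
    have G6 : env s6 by apply: env_frame F6 _.
    have [M20 M22 M19] : [/\ regs s6 20 = p, regs s6 22 = (a p - sg) * sg &
        regs s6 19 = (n - (p + 1)).+1] by case: F6 => F _; rewrite !F.
    have Hrow6 j : j < k -> (arrays s6 10 j != 0) = compat (a p) (sg + j).
      by case: F6 => _ ->; [apply: Hrow|].
    set e := arrays s5 5 ((n - (p + 1)).+1 + y.+1).
    have He : arrays s6 5 ((n - (p + 1)).+1 + (y + 1)) = e.
      by case: F6 => _ -> //; rewrite (addn1 y).
    have HLe : lcp_at n a p.+1 y.+1 e := HL y lt_y.
    have le_e : e <= n by case: HLe => + _ _ _; lia.
    have le_q : (n - (p + 1)).+1 <= n by lia.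
    apply: (wp_conseq (test_progP G6 lt_p lt_y ge_p M20 Er6 M22 M19 le_q Hrow6 He le_e)).
    move=> t7 s7 F7 [Ht7 B7]; split=> // s8 _ ->.
    set fail := _ || _ in B7.
    have fail_bad : fail -> ~ shift_ok (dist p y).
      case/orP => [/negP Hc Hok|Hst].
        by apply: Hc; apply: (shift_ok_dist sg1 Hok).
      by have := stop_bad (b := b) sg1 HLe Hst; rewrite /dist !subSS.
    have old d : arrays s7 9 d = 0 -> arrays s6 9 d = 0.
      by rewrite B7; case: ifP.
    split; first split.
    + move=> d Hd; rewrite B7; case: ifP => [/andP [Hf /eqP ->] _|_]; first exact: fail_bad.
      exact: K1.
    + by move=> d Hd /old; apply: K2.
    + by move=> p' y' H2 H3 H4 /old; apply: K3.
    move=> y' Hy' H0; case: (eqVneq y' y) H0 => [->|ney] H0; last first.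
      by apply: K4; [lia|apply: old].
    move: H0; rewrite B7 eqxx andbT; case: ifP => // /negbT.
    by rewrite negb_or negbK => /andP [Hc Hs] _; split=> //; exists e.
  move=> t6 s6 F6; rewrite E50 sum_cst => -[[K1 K2 K3] K4] Ht6; split.
    by rewrite ge_p; lia.
  move=> s7 _ ->; split=> // p' y Hp' Hy ge'.
  case: (eqVneq p' p) => [->|nep]; first exact: K4.
  by apply: K3 => //; lia.
move=> t3 s3 F3; rewrite E0 => -[J1 J2 J3] Ht3.
have G3 : env s3 by apply: env_frame F3 _.
have bad d : d < n -> (arrays s3 9 d == 0) <-> shift_ok d.
  move=> lt_d; split=> [/eqP E|Hok]; last by apply: contraT => /(J1 d lt_d).
  apply: (run_ok_shift sg1 ne lt_d); first exact: J2.
  by move=> p y Hp Hy ge Ed; apply: (J3 p y) => //; rewrite Ed.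
case: (G3) => {E0 E1 E2 E4 E6 EA EB} E0 E1 E2 E4 E6 EA EB.
steps.
apply: (@wp_for _ (fun i s4 =>
   (0 < i -> exists d, [/\ d < n - h, shift_ok d & regs s4 5 = n - d]) /\
   forall d, d < i -> shift_ok d -> regs s4 5 <= n - d) (fun=> 20)) => //.
- by rewrite /=; lia.
- move=> d s4; rewrite /= => lt_d F4 Er [L1 L2].
  have B4 : arrays s4 9 d = arrays s3 9 d by case: F4 => _ ->.
  have K0 : regs s4 0 = n by case: F4 => ->.
  have [Hb1 Hb2] := bad d ltac:(lia).
  apply: wp_if_neq0; ev => Hb; steps; (split; first lia) => s5 Hr _; rewrite Hr //.
    have nok : ~ shift_ok d by move/Hb2; rewrite (negbTE Hb).
    split=> [_|d' Hd' Hok]; last first.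
      by apply: L2 => //; case: (eqVneq d' d) Hok => [->|]; [|lia].
    (* Shift 0 is never marked, so register 5 is set in the first iteration and a cover of length
       [n] is always available. *)
    apply: L1; case: (posnP d) => // d0; case: nok; rewrite d0.
    exact: shift_ok0.
  split=> [_|d' Hd' _] /=; last by lia.
  by exists d; split=> //; apply: Hb1; rewrite Hb.
move=> t4 s4 F4; rewrite /= sum_cst => -[L1 L2] Ht4; split=> //; last first.
  by apply: L1; lia.
have Esum : \sum_(i < n) (60 + (sg <= a i) * (1100 * n + 100 * (k * sg)) + 8) =
    68 * n + k * (1100 * n + 100 * (k * sg)).
  set X := 1100 * n + _; rewrite -Hnk big_distrl /= (mulnC 68) -(sum_cst n 68) -big_split /=.
  by apply: eq_bigr => i _; lia.
rewrite Esum in Ht3.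
lia.
Qed.

End Machine.

(** * The input and the main program *)

Section Encoding.
Variable sg : nat.
Implicit Types (A : {set 'I_sg}) (S T : seq {set 'I_sg}).

Lemma nth_flatten_rows (x0 : nat) (rows : seq (seq nat)) j x :
  all (fun r => size r == sg) rows -> x < sg ->
  nth x0 (flatten rows) (j * sg + x) = nth x0 (nth [::] rows j) x.
Proof.
elim: rows j => [|r rows IH] j /=; first by rewrite !nth_nil.
case/andP => /eqP Er Hall lt_x; rewrite nth_cat Er; case: j => [|j].
  by rewrite mul0n add0n lt_x.
by rewrite mulSn -addnA ltnNge leq_addr /= addKn IH.
Qed.

(** A non-solid code counts the earlier non-solid positions; this makes that count the index of the
    symbol's row among the bit vectors. *)
Lemma nth_filter_count (X : Type) (x0 : X) (p : pred X) (s : seq X) i :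
  i < size s -> p (nth x0 s i) ->
  nth x0 (filter p s) (count p (take i s)) = nth x0 s i.
Proof.
elim: s i => [|x s IH] [|i] //= lt_i pi; first by rewrite pi.
by case: (p x) => /=; apply: IH.
Qed.

Lemma count_take_lt (X : Type) (x0 : X) (p : pred X) (s : seq X) i :
  i < size s -> p (nth x0 s i) -> count p (take i s) < count p s.
Proof.
elim: s i => [|x s IH] [|i] //= lt_i pi; first by rewrite pi.
by rewrite ltn_add2l; apply: IH.
Qed.

Lemma letter_set1 (o : 'I_sg) : letter [set o] = o.
Proof.
by rewrite /letter; case: pickP => [o'|/(_ o)]; rewrite inE ?eqxx // => /eqP ->.
Qed.

Definition code T (i : nat) : nat := nth 0 (symbol_codes T) i.

Lemma codeE T i : i < size T -> code T i =
  if solid_sym (nth set0 T i) then letter (nth set0 T i)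
  else sg + nonsolid_count (take i T).
Proof. by move=> lt_i; rewrite /code nth_mkseq. Qed.

Lemma solid_symP A : reflect (exists o, A = [set o]) (solid_sym A).
Proof. exact: cards1P. Qed.

Lemma code_solid T i : i < size T -> (code T i < sg) = solid_sym (nth set0 T i).
Proof.
move=> lt_i; rewrite codeE //; case: solid_symP => [[o ->]|_].
  by rewrite letter_set1 ltn_ord.
by rewrite ltnNge leq_addr.
Qed.

Lemma code_lt T i : i < size T -> code T i < sg + nonsolid_count T.
Proof.
move=> lt_i; have := code_solid lt_i; rewrite codeE //; case: ifP => Hs.
  by move=> lt; apply: leq_trans lt _; apply: leq_addr.
by move=> _; rewrite ltn_add2l; apply: (@count_take_lt _ set0) => //; rewrite Hs.
Qed.

Lemma has_letter_code T (b : nat -> nat) i (x : 'I_sg) : i < size T ->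
  (forall j, b j = nth 0 (bit_vectors T) j) ->
  has_letter sg b (code T i) x = (x \in nth set0 T i).
Proof.
move=> lt_i Hb; rewrite /has_letter code_solid // codeE //.
case: (boolP (solid_sym _)) => Hs.
  by case/solid_symP: Hs => o ->; rewrite letter_set1 inE.
rewrite addKn Hb /bit_vectors nth_flatten_rows //; last first.
  by rewrite all_map; apply/allP => A _ /=; rewrite size_map size_enum_ord.
have lt_c : nonsolid_count (take i T) < nonsolid_count T.
  by apply: (@count_take_lt _ set0) => //=; rewrite Hs.
rewrite (nth_map set0) ?size_filter // nth_filter_count ?Hs //.
by rewrite (nth_map x) ?size_enum_ord // nth_ord_enum eqb0 negbK.
Qed.

Lemma sum_nonsolid T :
  \sum_(i < size T) (sg <= code T i) = nonsolid_count T.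
Proof.
rewrite /nonsolid_count -sum1_count (big_nth set0) big_mkord [RHS]big_mkcond /=.
by apply: eq_bigr => i _; rewrite leqNgt code_solid //; case: solid_sym.
Qed.

Lemma occursP S T j : j < size T -> reflect (j + size S <= size T /\
    forall x, x < size S -> nth set0 S x :&: nth set0 T (j + x) != set0)
  (occurs S T j).
Proof.
move=> lt_j; rewrite /occurs /imatch all2E size_take_min size_drop.
apply: (iffP andP) => [[/eqP Es /allP H]|[le_n H]].
  have le : j + size S <= size T by lia.
  split=> // x lt_x; have lt_t : x < size (take (size S) (drop j T)).
    by rewrite size_take_min size_drop; lia.
  have Ez : size S = size (take (size S) (drop j T)) by rewrite size_take_min size_drop; lia.
  have Hz : nth (set0, set0) (zip S (take (size S) (drop j T))) x =
      (nth set0 S x, nth set0 T (j + x)).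
    by rewrite nth_zip //= nth_take // nth_drop.
  have := H (nth (set0, set0) (zip S (take (size S) (drop j T))) x).
  by rewrite mem_nth ?Hz => [/(_ isT)//|]; rewrite size_zip -Ez minnn.
split; first by lia.
apply/(all_nthP (set0, set0)) => x; rewrite size_zip size_take_min size_drop => lt_x.
rewrite nth_zip /=; last by rewrite size_take_min size_drop; lia.
by rewrite nth_take ?nth_drop; [apply: H|]; lia.
Qed.

Lemma coverP T (b : nat -> nat) m : 0 < size T ->
  (forall j, b j = nth 0 (bit_vectors T) j) ->
  (exists2 S, Defs.cover S T & size S = m) <->
  exists f, solid_cover (size T) sg (code T) b m f.
Proof.
move=> n0 Hb; split=> [[S [/andP [_ HS] HC] Em]|[f [Hf HC]]].
  have fP x : x < m -> exists o, nth set0 S x = [set o].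
    by rewrite -Em => lt_x; apply/solid_symP; apply: (allP HS); apply: mem_nth.
  exists (fun x => letter (nth set0 S x)); split=> [x /fP [o ->]|i lt_i].
    by rewrite letter_set1.
  have [j Hj] := HC i lt_i; have lt_j : j < size T by lia.
  case/(occursP _ lt_j); rewrite Em in Hj * => le_n H.
  exists j => //; split=> // x lt_x; have [o Eo] := fP x lt_x.
  have := H x lt_x; rewrite Eo letter_set1 has_letter_code //; last by lia.
  case/set0Pn => y; rewrite !inE => /andP [/eqP ->]; exact.
pose g x := if insub (f x) is Some o then [set o] else set0 : {set 'I_sg}.
have gP x : x < m -> exists2 o : 'I_sg, g x = [set o] & f x = o.
  by move=> /Hf lt; exists (Ordinal lt) => //; rewrite /g insubT.
exists (mkseq g m); last by rewrite size_mkseq.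
split=> [|i lt_i].
  apply/andP; split; apply/(all_nthP set0) => x; rewrite size_mkseq => lt_x;
    rewrite nth_mkseq //; have [o -> _] := gP x lt_x.
    by apply/set0Pn; exists o; rewrite inE.
  by apply/solid_symP; exists o.
have [d Hd [le_n H]] := HC i lt_i; exists d; rewrite ?size_mkseq //.
have lt_d : d < size T by lia.
apply/occursP => //; rewrite size_mkseq; split=> // x lt_x.
rewrite nth_mkseq //; have [o -> Eo] := gP x lt_x.
have := H x lt_x; rewrite Eo has_letter_code //; last by lia.
by move=> Ho; apply/set0Pn; exists o; rewrite !inE eqxx.
Qed.

End Encoding.

(** * Reversal and the choice of a half *)

Definition rev_code (n : nat) (c : nat -> nat) (i : nat) : nat := c (n - i.+1).

Lemma solid_cover_rev n sg c b m f : solid_cover n sg c b m f ->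
  solid_cover n sg (rev_code n c) b m (rev_code m f).
Proof.
case=> H1 H2; split=> [x lt_x|i lt_i]; first by apply: H1; lia.
have [|d Hd [le_n H]] := H2 (n - i.+1); first by lia.
exists (n - (d + m)); first by lia.
split=> [|x lt_x]; first by lia.
have := H (m - x.+1); rewrite /rev_code.
rewrite (_ : d + (m - x.+1) = n - (n - (d + m) + x).+1); last by lia.
by apply; lia.
Qed.

Lemma solid_cover_congr n sg a a' b m f : (forall i, i < n -> a i = a' i) ->
  solid_cover n sg a b m f -> solid_cover n sg a' b m f.
Proof.
move=> E [H1 H2]; split=> // i lt_i; have [d Hd [le_n H]] := H2 i lt_i.
by exists d => //; split=> // x lt_x; rewrite -E ?H //; lia.
Qed.

Lemma rev_codeK n c i : i < n -> rev_code n (rev_code n c) i = c i.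
Proof. by move=> lt_i; rewrite /rev_code; congr c; lia. Qed.

Lemma rank_rev n sg c j : j <= n ->
  rank sg c n = rank sg c (n - j) + rank sg (rev_code n c) j.
Proof.
elim: j => [|j IH] le_j; first by rewrite subn0 /rank big_ord0 addn0.
rewrite IH; last by lia.
rewrite (_ : n - j = (n - j.+1).+1); last by lia.
by rewrite !rankS; rewrite /rev_code; lia.
Qed.

Definition main_prog : cmd := (
  4 ::= #0 / (1 + 1);; 6 ::= #1 + #0;;
  For 20 0
    (If (0@[#20] < #1) Skip
       (2 ::= #2 + 1;; If (#20 < #4) (3 ::= #3 + 1) Skip));;
  If (#2 < #3 + #3)
    (For 20 0 (2@[#20] ::= 0@[#0 - (#20 + 1)]))
    (For 20 0 (2@[#20] ::= 0@[#20]));;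
  long_prog;; short_prog;;
  0 ::= #5)%ram.

Section Machine.
Variables (w n sg k : nat) (c b : nat -> nat).
Hypothesis w0 : 0 < w.
Hypothesis HW : 20 * n + 20 <= 2 ^ w.
Hypothesis HW2 : n * n + n <= 2 ^ w.
Hypothesis sgP : 1 < sg <= n.
Hypothesis c_lt : forall i, i < n -> c i < sg + k.
Hypothesis c_k : rank sg c n = k.
Hypothesis ne : forall i, i < n -> compat sg b (c i) (c i).

Lemma rank_le_size i : rank sg c i <= i.
Proof.
elim: i => [|i IH]; first by rewrite /rank big_ord0.
by rewrite rankS; case: (sg <= c i); lia.
Qed.

(** As [k.+1 <= 2 * maxn k 1], the long covers contribute 2 * 1500 + 200 to the constant and the
    short ones 2 * 3000; the rest is slack. *)
Lemma cover_progP a s : params w n sg k (n %/ 2) a -> env n sg k (n %/ 2) a b s ->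
  (forall i, i < n -> compat sg b (a i) (a i)) ->
  (forall d, d < n -> arrays s 9 d = 0) -> 2 * rank sg a (n %/ 2) <= k ->
  wp w (long_prog;; short_prog;; 0 ::= #5)%ram s (fun t s' =>
    [/\ t <= 95 * 100 * (n * maxn k 1 * sg ^ (k %/ 2)),
      exists f, solid_cover n sg a b (regs s' 0) f &
      forall m f, solid_cover n sg a b m f -> regs s' 0 <= m]).
Proof.
move=> Par Es ne' bad0 le_k.
apply: wp_comp; apply: (wp_conseq (long_progP Par ne' Es bad0)).
move=> t1 s1 F1 [Ht1 [d [lt_d Hok E5]] Hlong].
have G1 : env n sg k (n %/ 2) a b s1 by apply: env_frame F1 Es.
apply: wp_comp; apply: (wp_conseq (short_progP Par G1 E5 _)); first by lia.
move=> t2 s2 F2 [Ht2 B1 B2 B3].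
have h_half := par_h Par; have kn := par_k Par.
have sg1 : 1 < sg by lia.
steps; split.
- set D := sg ^ (k %/ 2).
  have D0 : 0 < D by rewrite expn_gt0; lia.
  have leD : sg ^ rank sg a (n %/ 2) <= D by rewrite leq_exp2l //; lia.
  set M := maxn k 1; have leM : k.+1 <= 2 * M by rewrite /M; lia.
  have leX : n * k.+1 <= 2 * (n * M) by rewrite mulnCA leq_mul2l leM orbT.
  have leY : n * M <= n * M * D by rewrite leq_pmulr.
  have leZ : sg ^ rank sg a (n %/ 2) * (n * k.+1) <= 2 * (n * M * D).
    by apply: leq_trans (leq_mul leD leX) _; lia.
  (* The cost of all rows. For [k <= 1] it is at most [sg <= n]; for [k > 1] one factor [sg] is
     absorbed by [D], whose exponent is positive. *)
  have leU : k * (k * sg) <= n * M * D.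
    case: (leqP k 1) => [le1|gt1].
      apply: leq_trans leY; rewrite mulnA -[n * M]mulnC; apply: leq_mul; last by lia.
      by rewrite /M; case: (k) le1 => [|[|]].
    rewrite mulnA; apply: leq_mul; first by rewrite /M; apply: leq_mul; lia.
    by rewrite -{1}(expn1 sg) leq_exp2l //; lia.
  have n1 : 0 < n * M by rewrite muln_gt0 /M; lia.
lia.
- rewrite /=; case: B2 => [->|//]; rewrite ?E5.
  exact: (@shift_ok_cover n sg (n %/ 2) a b sg1 h_half d).
- move=> m f Hc /=; case: (leqP m (n %/ 2)) => [le|gt]; first exact: B3 Hc.
  have [|le_m Hs] := cover_shift_ok (h := n %/ 2) sg1 h_half gt Hc; first by lia.
  apply: leq_trans B1 _; rewrite -E5.
  have -> : m = n - (n - m) by lia.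
  by apply: Hlong => //; lia.
Qed.

Lemma main_progP s :
  regs s 0 = n -> regs s 1 = sg -> regs s 2 = 0 -> regs s 3 = 0 ->
  (forall i, i < n -> arrays s 0 i = c i) -> (forall i, arrays s 1 i = b i) ->
  (forall d, arrays s 9 d = 0) ->
  wp w main_prog s (fun t s' =>
    [/\ t <= 98 * 100 * (n * maxn k 1 * sg ^ (k %/ 2)),
      exists f, solid_cover n sg c b (regs s' 0) f &
      forall m f, solid_cover n sg c b m f -> regs s' 0 <= m]).
Proof.
move=> E0 E1 E2 E3 EC EB bad0.
have kn : k <= n by rewrite -c_k rank_le_size.
rewrite /main_prog; steps.
set h := n %/ 2.
have h_half : 2 * h <= n <= 2 * h + 1 by rewrite /h; lia.
apply: (@wp_for _ (fun i s1 => regs s1 2 = rank sg c i /\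
   regs s1 3 = rank sg c (minn i h)) (fun=> 40)) => //.
- by rewrite /= E0; lia.
- by move=> s1 _ _ _ Hr; rewrite !Hr //= min0n /rank big_ord0.
- move=> i s1; rewrite /= E0 => lt_i F1 Er [I1 I2].
  have [G1 G4] : regs s1 1 = sg /\ regs s1 4 = h by case: F1 => F _; rewrite !F.
  have Ci : arrays s1 0 i = c i by case: F1 => _ -> //=; apply: EC.
  have R1 := rank_le_size i; have R2 := rank_le_size (minn i h).
  have RS := rankS sg c i.
  have RM : rank sg c (minn i.+1 h) =
      if i < h then rank sg c i.+1 else rank sg c (minn i h).
    by case: (ltnP i h) => lt; congr rank; lia.
  have Rm : i < h -> minn i h = i by lia.
  ifs => [lt|ge]; steps.
    split; first by lia.
    move=> s2 Hr _; rewrite !Hr // I1 I2 RM RS leqNgt lt addn0; split=> //.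
    by case: ifP => // /Rm ->.
  have gc : sg <= c i by lia.
  by ifs => lt; steps; (split; first lia) => s2 Hr _;
    rewrite !Hr //= ?I2 RM RS ?lt ?(negbTE lt) gc ?(Rm lt).
move=> t1 s1 F1; rewrite /= E0 sum_cst => -[I1 I2] Ht1.
rewrite c_k in I1; rewrite (_ : minn n h = h) in I2; last by lia.
have [G0 G1 G4 G6] : [/\ regs s1 0 = n, regs s1 1 = sg, regs s1 4 = h & regs s1 6 = sg + n].
  by case: F1 => F _; rewrite !F.
have C1 i : i < n -> arrays s1 0 i = c i by case: F1 => _ F lt_i; rewrite F //= EC.
have B1 i : arrays s1 1 i = b i by case: F1 => _ F; rewrite F //= EB.
have Z1 d : arrays s1 9 d = 0 by case: F1 => _ F; rewrite F //= bad0.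
have Rh := rank_le_size h.
pose rv := k < rank sg c h + rank sg c h.
pose a := if rv then rev_code n c else c.
have Hrev := @rank_rev n sg c.
(* After a reversal the first half holds what lies beyond position [n - h] of the original, that is
   [k] minus at least [rank sg c h], which exceeds half of [k]. *)
have le_a : 2 * rank sg a h <= k.
  rewrite /a /rv; case: ltnP => [lt|ge]; last by lia.
  have := Hrev h; have : rank sg c h <= rank sg c (n - h) by apply: rank_le; lia.
  by rewrite c_k; lia.
have Par : params w n sg k h a.
  split=> //; try lia.
    by move=> i lt_i; rewrite /a; case: (rv); rewrite ?/rev_code; apply: c_lt; lia.
  have -> : \sum_(i < n) (sg <= a i) = rank sg a n by [].
  rewrite /a; case: (rv) => //.
  by have := Hrev n (leqnn n); rewrite subnn c_k [rank sg c 0]/rank big_ord0.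
have ne_a i : i < n -> compat sg b (a i) (a i).
  by move=> lt_i; rewrite /a; case: (rv); rewrite ?/rev_code; apply: ne; lia.
have back m f : solid_cover n sg a b m f -> exists f', solid_cover n sg c b m f'.
  rewrite /a; case: (rv); last by exists f.
  move=> /solid_cover_rev Hc; exists (rev_code m f); apply: solid_cover_congr Hc.
  by move=> i; apply: rev_codeK.
have forth m f : solid_cover n sg c b m f -> exists f', solid_cover n sg a b m f'.
  rewrite /a; case: (rv); last by exists f.
  by move=> /solid_cover_rev Hc; exists (rev_code m f).
apply: wp_comp.
apply: (@wp_conseq _ _ _ (fun t s2 => t <= 30 * n + 20 /\
   forall i, i < n -> arrays s2 2 i = a i)).
  rewrite /a /rv; ifs => [->|/negbTE ->].
    apply: (@wp_for _ (fun i s2 => forall j, j < i ->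
      arrays s2 2 j = rev_code n c j) (fun=> 20)) => //.
    - by rewrite G0; lia.
    - move=> i s2; rewrite G0 => lt_i F2 Er IH.
      have K0 : regs s2 0 = n by case: F2 => ->.
      have Ci : arrays s2 0 (n - (i + 1)) = rev_code n c i.
        by case: F2 => _ -> //; rewrite C1 ?addn1 //; lia.
      steps; split; first lia.
      move=> s3 _ -> j Hj /=; case: (eqVneq j i) => [->//|nej]; apply: IH; lia.
    by move=> t s2 _; rewrite G0 sum_cst => H Ht; split=> //; rewrite /=; lia.
  apply: (@wp_for _ (fun i s2 => forall j, j < i -> arrays s2 2 j = c j) (fun=> 20)) => //.
  - by rewrite G0; lia.
  - move=> i s2; rewrite G0 => lt_i F2 Er IH.
    have Ci : arrays s2 0 i = c i by case: F2 => _ -> //; apply: C1.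
    steps; split; first lia.
    move=> s3 _ -> j Hj /=; case: (eqVneq j i) => [->//|nej]; apply: IH; lia.
  by move=> t s2 _; rewrite G0 sum_cst => H Ht; split=> //; rewrite /=; lia.
move=> t2 s2 F2 [Ht2 EA].
have G2 : env n sg k h a b s2.
  case: F2 => Fr Fa; split=> // [|||||i]; rewrite ?Fr ?Fa //.
apply: (wp_conseq (cover_progP Par G2 ne_a _ le_a)).
  by move=> d _; case: F2 => _ ->.
move=> t3 s3 F3 [Ht3 [f Hf] Hmin]; split.
- have X1 : n <= n * maxn k 1 * sg ^ (k %/ 2).
    by rewrite -mulnA leq_pmulr // muln_gt0 expn_gt0; lia.
  by lia.
- exact: back Hf.
- by move=> m f' /forth [f'' Hc]; apply: Hmin Hc.
Qed.

End Machine.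

Lemma input_regs sg w (T : seq {set 'I_sg}) r :
  regs (input_state w T) r = word w (nth 0 [:: size T; sg] r).
Proof. by []. Qed.

(** The exponent 6 is dictated by [n = 2]: there [20 * n + 20] is 60, which lies between 2^5 and
    2^6. *)
Lemma main_prog_input sg n (T : n.-tuple {set 'I_sg}) w :
  2 <= sg <= n -> istring T -> n ^ 6 <= 2 ^ w ->
  wp w main_prog (input_state w T) (fun t s =>
    t <= 98 * 100 * (n * maxn (nonsolid_count T) 1 * sg ^ (nonsolid_count T %/ 2)) /\
    shortest_cover_length T (regs s 0)).
Proof.
move=> sgP iT Hw; set k := nonsolid_count T.
have n1 : 1 < n by lia.
have En : size T = n := size_tuple T.
have le6 : 32 * n <= 2 ^ w.
  apply: leq_trans Hw; rewrite expnSr leq_mul2r; apply/orP; right.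
  by rewrite (@leq_exp2r 2 n 5).
have le3 : 2 * (n * n) <= 2 ^ w.
  apply: leq_trans Hw; rewrite (_ : n ^ 6 = n ^ 4 * (n * n)); last first.
    by rewrite mulnn -expnD.
  rewrite leq_mul2r; apply/orP; right; apply: (@leq_trans (2 ^ 4)) => //.
  by rewrite leq_exp2r.
have nn : n <= n * n by rewrite leq_pmulr //; lia.
have w0 : 0 < w by case: (w) le6 => //; rewrite expn0; lia.
have kn : k <= n by rewrite -En; apply: count_size.
have small x : x <= 2 * n -> word w x = x by move=> Hx; rewrite word_id //; lia.
have Hb j : word w (nth 0 (bit_vectors T) j) = nth 0 (bit_vectors T) j.
  apply: small; apply: (@leq_trans 1); last by lia.
  case: (ltnP j (size (bit_vectors T))) => [lt|ge]; last by rewrite nth_default.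
  have /flattenP [r /mapP [A _ ->] /mapP [x _ ->]] := mem_nth 0 lt.
  by case: (x \in A).
have c_lt i : i < n -> code T i < sg + k by move=> lt; apply: code_lt; rewrite En.
have has_c (i : nat) (x : 'I_sg) : i < n ->
    has_letter sg (nth 0 (bit_vectors T)) (code T i) x = (x \in nth set0 T i).
  by move=> lt; apply: has_letter_code; rewrite ?En.
have n0 : 0 < size T by rewrite En; lia.
have cov m := coverP m n0 (fun j => erefl (nth 0 (bit_vectors T) j)).
rewrite En in cov.
apply: (wp_conseq (@main_progP w n sg k (code T) (nth 0 (bit_vectors T)) w0 _ _ sgP c_lt _ _
   (input_state w T) _ _ _ _ _ _ _)).
- by lia.
- by lia.
- by have := sum_nonsolid T; rewrite En.
- move=> i lt_i; have : nth set0 T i != set0 by apply: (allP iT); apply: mem_nth; rewrite En.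
  by case/set0Pn => x Hx; apply/compatP; exists x; rewrite has_c.
- by rewrite input_regs /= En small //; lia.
- by rewrite input_regs /= small //; lia.
- by rewrite input_regs /= small.
- by rewrite input_regs /= small.
- by move=> i lt_i; rewrite /= small //; have := c_lt i lt_i; rewrite /code; lia.
- by move=> i; rewrite /= Hb.
- by move=> d; rewrite /= !nth_nil small.
move=> t s _ [Ht Hex Hmin]; split=> //; split; first by apply/cov.
move=> S HS; have /cov [f Hf] : exists2 S', Defs.cover S' T & size S' = size S by exists S.
exact: Hmin Hf.
Qed.

(* The word size is w >= d * log2 n, for a constant d of the algorithm. *)
Theorem theorem1 (R : realType) :
  exists (p : cmd) (d c : nat),
  forall (sigma n : nat) (T : n.-tuple {set 'I_sigma}) (w : nat),
    2 <= sigma <= n ->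
    istring T ->
    n ^ d <= 2 ^ w ->
    exists (t : nat) (s : state),
      [/\ exec w p (input_state w T) t s,
          shortest_cover_length T (regs s 0) &
          let k := nonsolid_count T in
          (t%:R <= c%:R * (n%:R * sigma%:R `^ (k%:R / 2%:R) * (maxn k 1)%:R) :> R)%R].
Proof.
exists main_prog, 6, (98 * 100) => sigma n T w sgP iT Hw.
have [t [s [Hex [Ht Hs]]]] := main_prog_input sgP iT Hw.
exists t, s; split=> //=; set k := nonsolid_count T in Ht *.
apply: (@le_trans _ _ (98 * 100 * (n * maxn k 1 * sigma ^ (k %/ 2)))%:R%R).
  by rewrite ler_nat.
rewrite !natrM ler_wpM2l ?mulr_ge0 ?ler0n // mulrAC ler_wpM2r ?ler0n //.
rewrite ler_wpM2l ?ler0n // natrX -powR_mulrn ?ler0n //.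
(* The program achieves the exponent k/2 rounded down; a base of at least 1 allows passing to the
   real exponent. *)
apply: ler_powR; first by rewrite ler1n; lia.
by rewrite ler_pdivlMr ?ltr0n // -natrM ler_nat; lia.
Qed.
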